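(* Let $N\ge2$ and consider the random graph $\mathcal G_N$ on $\Omega_N$ in which distinct $x,y$ with $d(x,y)=k$ are joined by an edge independently with probability $\min(c_k/N^{2k},1)$, where $$c_k=C_0+C_1\log k+C_2k^\alpha,\qquad \alpha\ge 0,\ C_0\ge0,\ C_1\ge0,\ C_2\ge 0.$$ (a) If $\alpha>2$, then for any $C_1$ there exist $C_0^*>0$ and $C_2^*>0$ such that if $C_0>C_0^*$ and $C_2>C_2^*$, percolation occurs and the percolation cluster (infinite cluster) is unique. (b) If $C_2=0$ and $C_1<N$, then percolation does not occur, for any $C_0$. (c) If $\alpha>2$, there exists $C_*>0$ such that if $\max(C_0,C_1,C_2)<C_*$, then percolation does not occur.
   Context: $\Omega_N$ is the set of sequences $x=(x_1,x_2,\dots)$ with $x_i\in\{0,\dots,N-1\}$ and only finitely many $x_i\ne0$. The hierarchical distance is $d(x,y)=0$ if $x=y$ and $d(x,y)=\max\{i:x_i\ne y_i\}$ otherwise (an ultrametric). $\mathbf 0$ is the zero sequence. All edges are independent. A cluster is a connected component. Percolation occurs if, with positive probability, $\mathbf 0$ belongs to an infinite cluster. *)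

(* Defs.v *)
From HB Require Import structures.
From mathcomp Require Import all_boot all_order all_algebra.
From mathcomp Require Import all_classical all_reals all_analysis.
Set Implicit Arguments. Unset Strict Implicit. Unset Printing Implicit Defensive.
Import Order.TTheory GRing.Theory Num.Theory.
Local Open Scope classical_set_scope.
Local Open Scope ring_scope.

(* Omega_N : sequences x = (x_1, x_2, ...) with entries in {0,..,N-1}, only
   finitely many nonzero.  Coordinate x_{i+1} is stored at index i. *)
Definition Omega (N : nat) : Type :=
  {x : nat -> nat | (forall i, (x i < N)%N) /\
                    exists M, forall i, (M <= i)%N -> x i = 0%N}.

Lemma origin_proof (N : nat) (hN : (1 < N)%N) :
  (forall i, ((fun _ : nat => 0%N) i < N)%N) /\
  exists M, forall i, (M <= i)%N -> (fun _ : nat => 0%N) i = 0%N.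
Proof. split; [move=> i; exact: ltnW | by exists 0%N]. Qed.

Definition origin (N : nat) (hN : (1 < N)%N) : Omega N :=
  exist _ (fun _ => 0%N) (origin_proof hN).

(* hdist x y k  <->  x <> y and d(x,y) = max{ i : x_i <> y_i } = k  (k >= 1) *)
Definition hdist (N : nat) (x y : Omega N) (k : nat) : Prop :=
  (0 < k)%N /\ sval x k.-1 <> sval y k.-1 /\
  forall i, (k <= i)%N -> sval x i = sval y i.

Definition ck {R : realType} (C0 C1 C2 alpha : R) (k : nat) : R :=
  C0 + C1 * ln (k%:R) + C2 * (k%:R `^ alpha).

Definition hier_model {R : realType} {d : measure_display}
    {T : measurableType d} (N : nat) (c : nat -> R)
    (P : probability T R) (edge : Omega N -> Omega N -> set T) : Prop :=
  [/\ (forall x y, measurable (edge x y)),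
      (forall x y, edge x y = edge y x),
      (forall x y k, hdist x y k ->
         P (edge x y) = (Num.min (c k / (N%:R ^+ (2 * k))) 1)%:E) &
      (forall (n : nat) (f : nat -> Omega N * Omega N),
         (forall i, (i < n)%N -> (f i).1 <> (f i).2) ->
         (forall i j, (i < n)%N -> (j < n)%N -> i <> j ->
            f i <> f j /\ f i <> ((f j).2, (f j).1)) ->
         P (\bigcap_(i in `I_n) edge (f i).1 (f i).2) =
         (\prod_(i < n) P (edge (f i).1 (f i).2))%E)].

Definition conn {d : measure_display} {T : measurableType d} (N : nat)
    (edge : Omega N -> Omega N -> set T) (w : T) (x y : Omega N) : Prop :=
  exists (n : nat) (f : nat -> Omega N),
    [/\ f 0%N = x, f n = y & forall i, (i < n)%N -> edge (f i) (f i.+1) w].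

Definition cluster {d : measure_display} {T : measurableType d} (N : nat)
    (edge : Omega N -> Omega N -> set T) (w : T) (x : Omega N) : set (Omega N) :=
  [set y | conn edge w x y].

Definition percolates {R : realType} {d : measure_display}
    {T : measurableType d} (N : nat) (hN : (1 < N)%N)
    (P : probability T R) (edge : Omega N -> Omega N -> set T) : Prop :=
  (0 < P [set w | ~ finite_set (cluster edge w (origin hN))])%E.

Definition unique_infinite_cluster {R : realType} {d : measure_display}
    {T : measurableType d} (N : nat)
    (P : probability T R) (edge : Omega N -> Omega N -> set T) : Prop :=
  P [set w | exists x y, [/\ ~ finite_set (cluster edge w x),
                             ~ finite_set (cluster edge w y) &
                             ~ conn edge w x y]] = 0%E.

(* Main.v *)
Require Import Defs.
From HB Require Import structures.
From mathcomp Require Import all_boot all_order all_algebra.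
From mathcomp Require Import reals.
From mathcomp.analysis Require Import sequences exp.
From mathcomp Require Import ring lra zify.
Set Implicit Arguments. Unset Strict Implicit. Unset Printing Implicit Defensive.
Import Order.TTheory GRing.Theory Num.Theory.
Local Open Scope ring_scope.

(* All estimates are made in the balls of radius K, where the edges form a finite product measure,
   with bounds uniform in K; the infinite graph is recovered at the very end by monotone limits,
   since a cluster is infinite iff it leaves every ball.

   (c) The expected number of self-avoiding paths of length n from a point, weighted by
   (9/8)^(distance reached), is at most 2^-n when the constants are small.

   (b) Choose 2^m radii with gaps 4m in [4m 2^m, 8m 2^m]. Edges jumping over two consecutive
   radii are negligible; the shells between consecutive radii are independent and each is free of
   edges with probability at least of order k^(-theta), with theta < 1 because C1 < N. So
   some shell is empty with probability close to 1, and the cluster of the origin stops there.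

   (a) Take scales with M_n balls of scale n in a ball of scale n+1, where n^(1+b) <= M_n <= C n^(1+b)
   and 2 + 2b < alpha. A ball is good when at most one of its sub-balls is bad and any two
   good sub-balls have their giants joined by an edge; its giant is the union of these giants. As
   sum 1/M_n is small the giants keep density 1/2, and the probability of being bad is
   O(M_n^-2), because the recursion eps_(n+1) = M^2 eps_n^2 + M^2 exp(- c n^alpha M^-2) preserves this order
   (here alpha > 2 is used). So the
   origin belongs to giants of all scales with probability at least 1/2.
   For uniqueness, let A be the cluster of a point inside a ball of radius k and f = c_k |A| N^-k.
   Given A, it leaves the ball with probability at most 3f, and it misses the giant of a sibling ball
   with probability about exp(-f/(2 N^2)) at most. The smaller of the two bounds stays away from 1, so
   over many well separated scales an infinite cluster a.s. meets a giant, and all giants around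
   the origin are connected to each other. *)

(** * Finite product measures *)

Lemma sum_prod_set {R : realFieldType} {I : finType} (f g : I -> R) :
  \prod_i (f i + g i) = \sum_(S : {set I}) \prod_i (if i \in S then f i else g i).
Proof. by rewrite bigA_distr; apply: eq_bigl. Qed.

Section ProductMeasure.
Context {R : realFieldType} {I : finType} (p : I -> R).
Hypothesis p01 : forall i, 0 <= p i <= 1.
Implicit Types (F G H : pred {set I}) (S A B J D : {set I}).

Definition wt S : R := \prod_i (if i \in S then p i else 1 - p i).
Definition pr F : R := \sum_(S | F S) wt S.
(** With A fixed and B random, [mix J A B] follows the conditional law given the restriction of A to
    J. In the same terms [dep J F] says that F is determined by the indices in J. *)
Definition mix J A B : {set I} := (A :&: J) :|: (B :\: J).
Definition dep J F := forall A B, F (mix J A B) = F A.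

Lemma in_mix J A B i : (i \in mix J A B) = if i \in J then i \in A else i \in B.
Proof. by rewrite !inE; case: (i \in J); rewrite /= ?andbT ?andbF ?orbF. Qed.

Lemma wt_ge0 S : 0 <= wt S.
Proof.
apply: prodr_ge0 => i _; have /andP[p0 p1] := p01 i.
by case: ifP => _ //; rewrite subr_ge0.
Qed.

Lemma sum_wt : \sum_S wt S = 1.
Proof.
have := sum_prod_set p (fun i => 1 - p i).
rewrite big1 => [|i _]; last by rewrite addrC subrK.
by move=> <-.
Qed.

Lemma eq_pr F G : F =1 G -> pr F = pr G.
Proof. by move=> FG; apply: eq_bigl. Qed.

Lemma pr_ge0 F : 0 <= pr F.
Proof. by apply: sumr_ge0 => S _; exact: wt_ge0. Qed.

Lemma le_pr F G : (forall S, F S -> G S) -> pr F <= pr G.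
Proof.
move=> FG; rewrite /pr [leRHS](bigID F) /=.
rewrite (eq_bigl F) => [|S]; last by apply: andb_idl; exact: FG.
by rewrite lerDl; apply: sumr_ge0 => S _; exact: wt_ge0.
Qed.

Lemma prT : pr predT = 1.
Proof. exact: sum_wt. Qed.

Lemma pr_le1 F : pr F <= 1.
Proof. by rewrite -prT; exact: le_pr. Qed.

Lemma prC F : pr (predC F) = 1 - pr F.
Proof.
rewrite -sum_wt (bigID F) /= /pr; set a := bigop _ _ _; set b := bigop _ _ _.
by rewrite [X in _ = X - _]addrC addrK.
Qed.

Lemma prU F G : pr (predU F G) <= pr F + pr G.
Proof.
have -> : pr (predU F G) = pr F + pr (predI (predC F) G).
  rewrite /pr (bigID F) /=; congr (_ + _); apply: eq_bigl => S /=;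
    by case: (F S); rewrite /= ?andbT ?andbF.
by rewrite lerD2l; apply: le_pr => S /andP[].
Qed.


Lemma pr_exists (T : finType) (Q : pred T) (F : T -> pred {set I}) :
  pr (fun S => [exists t, Q t && F t S]) <= \sum_(t | Q t) pr (F t).
Proof.
rewrite /pr; under [leRHS]eq_bigr do rewrite big_mkcond /=.
rewrite exchange_big /= [leLHS]big_mkcond /=.
apply: ler_sum => S _.
have s0 t : Q t -> 0 <= (if F t S then wt S else 0) by case: ifP => // _ _; exact: wt_ge0.
case: ifP => [/existsP[t /andP[Qt FtS]]|_]; last exact: sumr_ge0.
rewrite (bigD1 t) //= FtS lerDl; by apply: sumr_ge0 => u /andP[Qu _]; apply: s0.
Qed.

Lemma prU_seq (F : nat -> pred {set I}) n :
  pr (fun S => has (F^~ S) (iota 0 n)) <= \sum_(i < n) pr (F i).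
Proof.
elim: n => [|n IHn]; first by rewrite big_ord0 /pr big_pred0.
rewrite big_ord_recr; apply: le_trans (lerD IHn (lexx _)).
apply: le_trans (prU _ _); apply: le_pr => S.
by rewrite -[in iota _ _]addn1 iotaD has_cat /= orbF.
Qed.

Lemma wt_mix J A B : wt (mix J A B) * wt (mix J B A) = wt A * wt B.
Proof.
rewrite /wt -!big_split /=; apply: eq_bigr => i _; rewrite !in_mix.
by case: (i \in J) => //; rewrite mulrC.
Qed.

Lemma mixK J A B : mix J (mix J A B) (mix J B A) = A.
Proof. by apply/setP => i; rewrite !in_mix; case: (i \in J). Qed.

(* The swap (A, B) |-> (mix J A B, mix J B A) is an involution preserving the product weight. *)
Lemma pr_mix J F : pr F = \sum_A wt A * pr (fun B => F (mix J A B)).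
Proof.
pose sw (q : {set I} * {set I}) := (mix J q.1 q.2, mix J q.2 q.1).
have swK : involutive sw by move=> [A B]; rewrite /sw /= !mixK.
transitivity (\sum_(q : {set I} * {set I}) wt q.1 * (wt q.2 * (F q.1)%:R)).
  rewrite -(pair_bigA _ (fun A B => wt A * (wt B * (F A)%:R))) /=.
  rewrite /pr big_mkcond; apply: eq_bigr => A _.
  rewrite -big_distrr -big_distrl /= sum_wt mul1r.
  by case: (F A); rewrite ?mulr1 ?mulr0.
rewrite (reindex_inj (inv_inj swK)) /=.
rewrite (eq_bigr (fun q : {set I} * {set I} =>
  wt q.1 * (wt q.2 * (F (mix J q.1 q.2))%:R))); last first.
  by move=> [A B] _ /=; rewrite !mulrA wt_mix.
rewrite -(pair_bigA _ (fun A B => wt A * (wt B * (F (mix J A B))%:R))) /=.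
apply: eq_bigr => A _; rewrite -big_distrr /=; congr (_ * _).
rewrite /pr [RHS]big_mkcond; apply: eq_bigr => B _.
by case: (F _); rewrite ?mulr1 ?mulr0.
Qed.

(** The form in which one conditions on explored edges: F is decided on J, and q bounds the chance
    of G once everything off J is resampled. It follows from [pr_mix] by comparing the averages over
    A term by term. *)
Lemma pr_cond J F G q : 0 <= q -> dep J F ->
  (forall A, F A -> pr (fun B => G (mix J A B)) <= q) ->
  pr (predI F G) <= q * pr F.
Proof.
move=> q0 dF hG; rewrite (pr_mix J) [in leRHS]/pr [X in _ <= _ * X]big_mkcond mulr_sumr.
apply: ler_sum => A _; case: ifP => FA.
  rewrite mulrC; apply: ler_wpM2r; first exact: wt_ge0.
  by apply: le_trans (hG A FA); apply: le_pr => S /andP[].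
rewrite mulr0 (_ : pr _ = 0) ?mulr0 //.
by rewrite /pr big_pred0 // => B /=; rewrite dF FA.
Qed.

Lemma pr_indep J D F G : dep J F -> dep D G -> [disjoint J & D] ->
  pr (predI F G) = pr F * pr G.
Proof.
move=> dF dG JD; rewrite (pr_mix J) /= [in RHS]/pr mulr_suml [RHS]big_mkcond.
apply: eq_bigr => A _.
case: (boolP (F A)) => FA; last first.
  by rewrite /pr big_pred0 ?mulr0 // => B; rewrite dF (negbTE FA).
congr (_ * _); apply: eq_pr => B; rewrite dF FA /=.
rewrite -(dG (mix J A B) B) -[RHS](dG B B); congr (G _); apply/setP => i.
rewrite !in_mix; case: ifP => // iD; case: ifP => // iJ.
by move: (disjointFr JD iJ); rewrite iD.
Qed.

Lemma pr_disjoint D : pr (fun S => [disjoint D & S]) = \prod_(i in D) (1 - p i).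
Proof.
(* Replacing p by 0 on D removes the sets that meet D from the expanded product. *)
have := sum_prod_set (fun i => if i \in D then 0 else p i) (fun i => 1 - p i).
rewrite (bigID (mem D)) /= (eq_bigr (fun i => 1 - p i)); last first.
  by move=> i iD; rewrite iD add0r.
rewrite [X in _ * X]big1 ?mulr1 => [->|i /negbTE iD]; last first.
  by rewrite iD addrC subrK.
rewrite /pr [LHS]big_mkcond /=.
apply: eq_bigr => S _; case: ifP => [DS|].
  apply: eq_bigr => i _; case: ifP => // iS; case: ifP => // iD.
  by move: (disjointFr DS iD); rewrite iS.
move=> /negbT; rewrite -setI_eq0 => /set0Pn[i]; rewrite inE => /andP[iD iS].
by rewrite (bigD1 i) //= iS iD mul0r.
Qed.

Lemma pr_in i : pr (fun S => i \in S) = p i.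
Proof.
have := prC (fun S => [disjoint [set i] & S]).
rewrite pr_disjoint big_set1 opprB addrC subrK => <-; apply: eq_pr => S /=.
by rewrite disjoints1 negbK.
Qed.

Lemma dep_sub J D F : J \subset D -> dep J F -> dep D F.
Proof.
move=> JD dF A B; rewrite -(dF (mix D A B) A) -[RHS](dF A A); congr (F _).
apply/setP => i; rewrite !in_mix; case: ifP => // iJ.
by rewrite (subsetP JD).
Qed.

Lemma depI J F G : dep J F -> dep J G -> dep J (predI F G).
Proof. by move=> dF dG A B; rewrite /= dF dG. Qed.

(** Exploration along increasing index sets: the first i events depend on [J i] only, so by
    [pr_cond] the next one contributes a factor q whatever has been seen. *)
Lemma pr_chain (J : nat -> {set I}) (W : nat -> pred {set I}) q n :
  0 <= q -> (forall i, (i < n)%N -> J i \subset J i.+1) ->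
  (forall i, (i < n)%N -> dep (J i.+1) (W i)) ->
  (forall i A, (i < n)%N -> pr (fun B => W i (mix (J i) A B)) <= q) ->
  pr (fun S => all (W^~ S) (iota 0 n)) <= q ^+ n.
Proof.
move=> q0 JS dW hW.
have dP m : (m <= n)%N -> dep (J m) (fun S => all (W^~ S) (iota 0 m)).
  elim: m => [|m IHm] mn A B //.
  rewrite -[in iota 0 _]addn1 iotaD !all_cat /= !andbT add0n dW //; congr (_ && _).
  exact: dep_sub (JS _ mn) (IHm (ltnW mn)) A B.
suff : forall m, (m <= n)%N -> pr (fun S => all (W^~ S) (iota 0 m)) <= q ^+ m.
  by apply.
elim=> [|m IHm] mn; first by rewrite expr0 pr_le1.
apply: (@le_trans _ _ (pr (predI (fun S => all (W^~ S) (iota 0 m)) (W m)))).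
  by apply: le_pr => S; rewrite -[m.+1]addn1 iotaD all_cat /= andbT.
apply: le_trans (pr_cond q0 (dP _ (ltnW mn)) _) _.
  by move=> A _; exact: hW.
by rewrite exprS ler_wpM2l // IHm // ltnW.
Qed.

End ProductMeasure.

(** * Random graphs on a finite ultrametric space *)

(** Abstract form of the ball of radius K in Omega_N, with [hd] for the hierarchical distance; the
    instance is the set of words of length K. *)
Record ultra (V : finType) (N K : nat) (hd : V -> V -> nat) : Prop := Ultra {
  hd_eq0 : forall u v, (hd u v == 0%N) = (u == v);
  hd_sym : forall u v, hd u v = hd v u;
  hd_ultra : forall v u w, (hd u w <= maxn (hd u v) (hd v w))%N;
  hd_leK : forall u v, (hd u v <= K)%N;
  card_hd : forall u k, (k <= K)%N -> #|[set v | (hd u v <= k)%N]| = (N ^ k)%N }.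

Section Graph.
Context {R : realFieldType} {V : finType} {N K : nat} {hd : V -> V -> nat}.
Hypothesis uV : ultra N K hd.
Hypothesis N1 : (1 < N)%N.
Implicit Types (A B C D U : {set V}) (u v w x y z : V) (S T J : {set {set V}}).

Definition ball u k : {set V} := [set v | (hd u v <= k)%N].
(** A configuration is a family of vertex sets, so edges are unordered pairs; the test [u != v]
    excludes singletons. *)
Definition adj S u v := (u != v) && ([set u; v] \in S).
Definition edges A B : {set {set V}} := [set [set q.1; q.2] | q in setX A B].
Definition joined A B S := [exists u in A, exists v in B, adj S u v].

Lemma joinedP A B S :
  reflect (exists u v, [/\ u \in A, v \in B & adj S u v]) (joined A B S).
Proof.
apply: (iffP existsP) => [[u /andP[uA /existsP[v /andP[vB a]]]]|[u [v [uA vB a]]]].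
  by exists u, v.
by exists u; rewrite uA; apply/existsP; exists v; rewrite vB.
Qed.

Lemma adj_sym S : symmetric (adj S).
Proof. by move=> u v; rewrite /adj eq_sym setUC. Qed.

Lemma hdxx u : hd u u = 0%N.
Proof. by apply/eqP; rewrite (hd_eq0 uV). Qed.

Lemma ball_refl u k : u \in ball u k.
Proof. by rewrite inE hdxx. Qed.

Lemma ballE u v k : v \in ball u k -> ball u k = ball v k.
Proof.
rewrite inE => uv; apply/setP => w; rewrite !inE; apply/idP/idP => h.
  by rewrite (leq_trans (hd_ultra uV u v w)) // geq_max (hd_sym uV) uv.
by rewrite (leq_trans (hd_ultra uV v u w)) // geq_max uv.
Qed.

Lemma ball_sub u k l : (k <= l)%N -> ball u k \subset ball u l.
Proof. by move=> kl; apply/subsetP => v; rewrite !inE => /leq_trans; apply. Qed.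

Lemma ball_disj u v k : v \notin ball u k -> [disjoint ball u k & ball v k].
Proof.
move=> uv; rewrite -setI_eq0; apply/eqP/setP => w; rewrite !inE.
apply/negbTE/negP => /andP[h1 h2]; case/negP: uv.
by rewrite inE (leq_trans (hd_ultra uV w u v)) // geq_max h1 (hd_sym uV).
Qed.

Lemma set2_inj u v u' v' : u != v' -> [set u; v] = [set u'; v'] -> u = u' /\ v = v'.
Proof.
move=> uv' e; have : u \in [set u'; v'] by rewrite -e set21.
rewrite !inE (negbTE uv') orbF => /eqP uu'; split=> //; subst u'.
have : v \in [set u; v'] by rewrite -e set22.
rewrite !inE => /orP[/eqP vu|/eqP //]; subst v.
have : v' \in [set u; u] by rewrite e set22.
by rewrite !inE orbb eq_sym (negbTE uv').
Qed.

Lemma edges_inj A B : [disjoint A & B] ->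
  {in setX A B &, injective (fun q : V * V => [set q.1; q.2])}.
Proof.
move=> AB [u v] [u' v']; rewrite !inE /= => /andP[uA vB] /andP[uA' vB'] e.
have uv' : u != v' by apply: contraTN vB' => /eqP <-; rewrite (disjointFr AB).
by have [-> ->] := set2_inj uv' e.
Qed.

Lemma mem_edges A B u v : u \in A -> v \in B -> [set u; v] \in edges A B.
Proof. by move=> uA vB; apply/imsetP; exists (u, v); rewrite ?inE ?uA. Qed.

Lemma edgesE A u v : ([set u; v] \in edges A A) = (u \in A) && (v \in A).
Proof.
apply/idP/idP => [/imsetP[[a b]]|/andP[]]; last exact: mem_edges.
rewrite inE /= => /andP[aA bA] e.
have : u \in [set a; b] by rewrite -e set21.
have : v \in [set a; b] by rewrite -e set22.
by rewrite !inE => /orP[]/eqP-> /orP[]/eqP->; rewrite ?aA ?bA.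
Qed.

Lemma edgesS A B C D : A \subset C -> B \subset D -> edges A B \subset edges C D.
Proof.
move=> AC BD; apply: imsetS; apply/subsetP => q; rewrite !inE => /andP[qA qB].
by rewrite (subsetP AC) // (subsetP BD).
Qed.

Lemma edges_disj A B : [disjoint A & B] -> [disjoint edges A A & edges B B].
Proof.
move=> AB; rewrite -setI_eq0; apply/eqP/setP => e; rewrite !inE.
apply/negbTE/negP => /andP[/imsetP[[u v]]]; rewrite inE /= => /andP[uA _] ->.
by rewrite edgesE (disjointFr AB uA).
Qed.

Lemma adj_mix J S T u v :
  adj (mix J S T) u v = if [set u; v] \in J then adj S u v else adj T u v.
Proof. by rewrite /adj in_mix; case: ifP. Qed.

Lemma adj_mix_in A S T u v : u \in A -> v \in A ->
  adj (mix (edges A A) S T) u v = adj S u v.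
Proof. by move=> uA vA; rewrite adj_mix edgesE uA vA. Qed.

Lemma adj_mix_out A S T u v : v \notin A ->
  adj (mix (edges A A) S T) u v = adj T u v.
Proof. by move=> vA; rewrite adj_mix edgesE (negbTE vA) andbF. Qed.

Lemma eq_joined A B S T : (forall u v, u \in A -> v \in B -> adj S u v = adj T u v) ->
  joined A B S = joined A B T.
Proof.
by move=> h; apply/joinedP/joinedP => -[u [v [uA vB a]]]; exists u, v; split=> //;
  rewrite ?h // -h.
Qed.

Lemma dep_joined C A B : A \subset C -> B \subset C -> dep (edges C C) (joined A B).
Proof.
move=> AC BC S T; apply: eq_joined => u v uA vB.
by rewrite adj_mix_in //; [exact: (subsetP AC) | exact: (subsetP BC)].
Qed.

Lemma joined_mix A B C S T : [disjoint B & C] ->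
  joined A B (mix (edges C C) S T) = joined A B T.
Proof.
move=> BC; apply: eq_joined => u v uA vB.
by rewrite adj_mix_out // (disjointFr BC).
Qed.

Lemma joined_disjoint A B S : [disjoint A & B] ->
  ~~ joined A B S = [disjoint edges A B & S].
Proof.
move=> AB; apply/idP/idP.
  apply: contraR; rewrite -setI_eq0 => /set0Pn[e]; rewrite inE => /andP[].
  case/imsetP => -[u v]; rewrite inE /= => /andP[uA vB] -> uvS.
  apply/joinedP; exists u, v; split=> //; rewrite /adj uvS andbT.
  by apply: contraTneq uA => ->; rewrite (disjointFl AB).
move=> ds; apply/joinedP => -[u [v [uA vB /andP[_ uvS]]]].
by move: (disjointFr ds (mem_edges uA vB)); rewrite uvS.
Qed.

Lemma card_sphere u j : (j < K)%N ->
  #|[set v | hd u v == j.+1]| = (N ^ j.+1 - N ^ j)%N.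
Proof.
move=> jK; rewrite -(card_hd uV u jK) -(card_hd uV u (ltnW jK)).
rewrite -cardsDS; last by apply: (ball_sub u (leqnSn j)).
by apply: eq_card => v; rewrite !inE eqn_leq andbC ltnNge.
Qed.

Lemma card_sphere_le u j : (#|[set v | hd u v == j]| <= N ^ j)%N.
Proof.
have [jK|jK] := leqP j K.
  rewrite -(card_hd uV u jK); apply: subset_leq_card; apply/subsetP => v.
  by rewrite !inE => /eqP ->.
rewrite eq_card0 // => v; rewrite !inE; apply/negbTE/eqP => e.
by move: jK; rewrite -e ltnNge (hd_leK uV).
Qed.

Lemma sum_hd u (P : pred nat) (g : nat -> R) :
  \sum_(v | P (hd u v)) g (hd u v) =
  \sum_(j < K.+1 | P j) #|[set v | hd u v == j]|%:R * g j.
Proof.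
rewrite (partition_big (fun v => (inord (hd u v) : 'I_K.+1)) P) /=; last first.
  by move=> v Pv; rewrite inordK // ltnS (hd_leK uV).
apply: eq_bigr => j Pj.
rewrite (eq_bigl (fun v => v \in [set v | hd u v == j])); last first.
  move=> v; rewrite [in RHS]inE -val_eqE /= inordK ?ltnS ?(hd_leK uV) //.
  by case: eqP => [->|]; rewrite ?Pj ?andbF.
rewrite (eq_bigr (fun=> g j)) => [|v]; last by rewrite inE => /eqP ->.
by rewrite sumr_const mulr_natl.
Qed.

Lemma sum_hd_le u (P : pred nat) (g : nat -> R) : (forall j, P j -> 0 <= g j) ->
  \sum_(v | P (hd u v)) g (hd u v) <= \sum_(j < K.+1 | P j) N%:R ^+ j * g j.
Proof.
move=> g0; rewrite sum_hd; apply: ler_sum => j Pj; apply: ler_wpM2r; first exact: g0.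
by rewrite -natrX ler_nat card_sphere_le.
Qed.

(** * Edge probabilities and union bounds *)

Section Probability.
Context (c : nat -> R) (pe : {set V} -> R).
Hypothesis c0 : forall j, (0 < j)%N -> 0 <= c j.
Hypothesis pe01 : forall e, 0 <= pe e <= 1.
Definition edgep j : R := Num.min (c j / N%:R ^+ (2 * j)) 1.
Hypothesis peE : forall u v, u != v -> pe [set u; v] = edgep (hd u v).

Lemma N_gt0 : 0 < N%:R :> R. Proof. by rewrite ltr0n; apply: leq_trans N1. Qed.

Lemma edgep_le j : edgep j <= c j / N%:R ^+ (2 * j).
Proof. by rewrite /edgep ge_min lexx. Qed.

Lemma hd_gt0 u v : (0 < hd u v)%N = (u != v).
Proof. by rewrite lt0n (hd_eq0 uV). Qed.

Lemma pr_adj u v : u != v -> pr pe (fun S => adj S u v) = edgep (hd u v).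
Proof.
move=> uv; rewrite -peE // -(pr_in pe); apply: eq_pr => S.
by rewrite /adj uv.
Qed.

Lemma pr_not_joined A B : [disjoint A & B] ->
  pr pe (predC (joined A B)) = \prod_(u in A) \prod_(v in B) (1 - edgep (hd u v)).
Proof.
move=> AB; rewrite (@eq_pr _ _ _ _ (fun S => [disjoint edges A B & S])); last first.
  by move=> S; rewrite /= joined_disjoint.
rewrite pr_disjoint big_imset /=; last exact: edges_inj.
rewrite pair_big_dep /=; apply: eq_big => [[u v]|[u v]]; first by rewrite inE.
rewrite inE /= => /andP[uA vB]; rewrite peE //.
by apply: contraTneq uA => ->; rewrite (disjointFl AB).
Qed.

Lemma pr_joined_le A B : [disjoint A & B] ->
  pr pe (joined A B) <= \sum_(u in A) \sum_(v in B) c (hd u v) / N%:R ^+ (2 * hd u v).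
Proof.
move=> AB; apply: le_trans (pr_exists pe01 (fun u => u \in A) (fun u S => [exists v in B, adj S u v])) _.
apply: ler_sum => u uA.
apply: le_trans (pr_exists pe01 (fun v => v \in B) (fun v S => adj S u v)) _.
apply: ler_sum => v vB; rewrite pr_adj ?edgep_le //.
by apply: contraTneq uA => ->; rewrite (disjointFl AB).
Qed.

(** Union bound: each point of A has at most N^j points at distance j, each joined to it with
    probability at most c_j / N^(2j). *)
Lemma pr_joined_out A B k : (forall u v, u \in A -> v \in B -> (k < hd u v)%N) ->
  pr pe (joined A B) <= #|A|%:R * \sum_(j < K.+1 | (k < j)%N) c j / N%:R ^+ j.
Proof.
move=> AB; have dAB : [disjoint A & B].
  rewrite -setI_eq0; apply/eqP/setP => u; rewrite !inE; apply/negbTE/negP.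
  by case/andP=> uA uB; have := AB u u uA uB; rewrite hdxx.
apply: le_trans (pr_joined_le dAB) _; rewrite mulr_natl -sumr_const.
have q0 j : (k < j)%N -> 0 <= c j / N%:R ^+ (2 * j).
  by move=> kj; rewrite divr_ge0 ?exprn_ge0 ?ler0n ?c0 // (leq_ltn_trans _ kj).
apply: ler_sum => u uA.
apply: (@le_trans _ _ (\sum_(v | (k < hd u v)%N) c (hd u v) / N%:R ^+ (2 * hd u v))).
  rewrite big_mkcond [leRHS]big_mkcond; apply: ler_sum => v _.
  case: ifP => [vB|_]; first by rewrite AB.
  by case: ifP => // /q0.
apply: le_trans (sum_hd_le u q0) _; apply: ler_sum => j _.
have NE : N%:R ^+ j != 0 :> R by rewrite expf_neq0 // gt_eqF // N_gt0.
rewrite mul2n -addnn exprD le_eqVlt; apply/orP; left; apply/eqP.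
by field.
Qed.

(** * Self-avoiding walks weighted exponentially in the distance *)

Section Subcritical.
Variable lam : R.
Hypothesis lam1 : 1 <= lam.
(** At most N^j points lie at distance j, so this sum bounds the expectation of lam^(distance)
    summed over the neighbours of a point. *)
Hypothesis small : \sum_(j < K.+1 | (0 < j)%N) c j * (lam / N%:R) ^+ j <= 2^-1.

(* U collects the vertices that the walk may no longer visit. *)
Fixpoint walk n U x y S : bool :=
  if n is n'.+1 then [exists z, (z \notin x |: U) && (adj S x z && walk n' (x |: U) z y S)]
  else x == y.

(** Convolution power of the edge probabilities. Unlike [walk] it keeps no record of visited
    vertices, which gives a recursion in n alone. *)
Fixpoint green n x y : R :=
  if n is n'.+1 then \sum_(z | z != x) edgep (hd x z) * green n' z y else (x == y)%:R.

Lemma dep_walk n U x y : x \notin U -> dep (edges (~: U) (~: U)) (walk n U x y).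
Proof.
elim: n U x => [|n IHn] U x xU S T //=; apply: eq_existsb => z.
case: (boolP (z \in x |: U)) => //= zU.
have zU' : z \notin U by apply: contra zU; rewrite !inE => ->; rewrite orbT.
rewrite adj_mix_in ?inE //; congr (_ && _).
apply: (dep_sub _ (IHn _ _ zU)); apply: edgesS; rewrite setCS subsetUr //.
Qed.

Lemma edgep_ge0 j : (0 < j)%N -> 0 <= edgep j.
Proof. by move=> j0; rewrite le_min ler01 divr_ge0 ?exprn_ge0 ?ler0n ?c0. Qed.

(** The first edge contains x and the rest of the walk avoids x ([dep_walk]), so the two are
    independent and the bound propagates by induction. *)
Lemma pr_walk n U x y : pr pe (walk n U x y) <= green n x y.
Proof.
elim: n U x => [|n IHn] U x /=.
  by case: eqP => _; [exact: pr_le1 | rewrite /pr big_pred0].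
apply: le_trans (pr_exists pe01 (fun z => z \notin x |: U) _) _.
rewrite big_mkcond [leRHS]big_mkcond; apply: ler_sum => z _.
case: ifP => [zU|_]; last first.
  case: ifP => // zx; apply: mulr_ge0; first by rewrite edgep_ge0 // hd_gt0 eq_sym.
  exact: le_trans (pr_ge0 pe01 _) (IHn U z).
have zx : z != x by apply: contra zU; rewrite !inE => ->.
have dA : dep [set [set x; z]] (fun S => adj S x z).
  by move=> S T; rewrite adj_mix set11.
rewrite zx (pr_indep _ dA (dep_walk n y zU)); last first.
  by rewrite disjoints1 edgesE !inE eqxx.
by rewrite pr_adj 1?eq_sym //; apply: ler_wpM2l => //; rewrite edgep_ge0 // hd_gt0 eq_sym.
Qed.

Lemma green_ge0 n x y : 0 <= green n x y.
Proof. exact: le_trans (pr_ge0 pe01 _) (pr_walk n set0 x y). Qed.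

(** The ultrametric inequality and [lam1] make the weight submultiplicative along a walk, so every
    step costs the factor 1/2 of [small]. *)
Lemma sum_green n x : \sum_y lam ^+ hd x y * green n x y <= 2^-1 ^+ n.
Proof.
have lam0 : 0 <= lam by apply: le_trans lam1.
elim: n x => [|n IHn] x /=.
  rewrite (bigD1 x) //= big1 => [|y]; last by rewrite eq_sym => /negbTE ->; rewrite mulr0.
  by rewrite hdxx eqxx expr0 mulr1 addr0.
apply: (@le_trans _ _ (\sum_(z | z != x) edgep (hd x z) * lam ^+ hd x z * 2^-1 ^+ n)).
  rewrite (eq_bigr (fun y => \sum_(z | z != x) edgep (hd x z) * (lam ^+ hd x y * green n z y))).
    rewrite exchange_big /=; apply: ler_sum => z zx.
    have p0 : 0 <= edgep (hd x z) by rewrite edgep_ge0 // hd_gt0 eq_sym.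
    rewrite -mulr_sumr -mulrA; apply: ler_wpM2l => //.
    apply: le_trans (ler_wpM2l (exprn_ge0 _ lam0) (IHn z)).
    rewrite mulr_sumr; apply: ler_sum => y _; rewrite mulrA ler_wpM2r ?green_ge0 //.
    rewrite -exprD; apply: ler_weXn2l => //; apply: leq_trans (hd_ultra uV z x y) _.
    by rewrite geq_max leq_addr leq_addl.
  by move=> y _; rewrite mulr_sumr; apply: eq_bigr => z _; rewrite mulrCA.
rewrite -mulr_suml exprS; apply: ler_wpM2r; first by rewrite exprn_ge0 // invr_ge0.
apply: le_trans small.
rewrite (eq_bigl (fun z => (0 < hd x z)%N)); last by move=> z; rewrite hd_gt0 eq_sym.
have g0 j : (0 < j)%N -> 0 <= c j / N%:R ^+ (2 * j) * lam ^+ j.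
  by move=> j0; rewrite mulr_ge0 ?exprn_ge0 ?divr_ge0 ?exprn_ge0 ?ler0n ?c0.
apply: (@le_trans _ _ (\sum_(z | (0 < hd x z)%N)
    c (hd x z) / N%:R ^+ (2 * hd x z) * lam ^+ (hd x z))).
  by apply: ler_sum => z _; rewrite ler_wpM2r ?exprn_ge0 ?edgep_le.
apply: le_trans (sum_hd_le x g0) _; apply: ler_sum => j _.
have NE : N%:R ^+ j != 0 :> R by rewrite expf_neq0 // gt_eqF // N_gt0.
rewrite expr_div_n mul2n -addnn exprD le_eqVlt; apply/orP; left; apply/eqP.
by field.
Qed.

Lemma connect_walk S x y : connect (adj S) x y ->
  exists2 n, (n < #|V|)%N & walk n set0 x y S.
Proof.
case/connectP => p0 /shortenP[p pp up _] -> {p0 y}.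
have sp : (size p < #|V|)%N.
  by have := max_card (mem (x :: p)); rewrite (card_uniqP up).
exists (size p) => //.
have : all (fun z => z \notin (set0 : {set V})) p by apply/allP => z; rewrite inE.
elim: p x {sp} (set0 : {set V}) pp up => [|z p IHp] x U //=.
move=> /andP[xz pz] /andP[xp up] /andP[zU pU].
apply/existsP; exists z; rewrite xz /= !inE negb_or zU.
have -> : z != x by move: xp; rewrite inE negb_or eq_sym => /andP[].
apply: IHp => //; apply/allP => w wp; rewrite !inE negb_or (allP pU) // andbT.
by apply: contraNneq xp => <-; rewrite inE wp orbT.
Qed.

(** Beyond distance k the weight is at least lam^k, so [sum_green] bounds the expected number of
    walks of length n ending there by lam^(-k) 2^(-n); then one sums over n. *)
Lemma pr_connect_far x k :
  pr pe (fun S => [exists y, (k < hd x y)%N && connect (adj S) x y]) <= 2 * lam ^- k.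
Proof.
have lam0 : 0 < lam by apply: lt_le_trans lam1.
apply: (@le_trans _ _ (\sum_(y | (k < hd x y)%N) \sum_(n < #|V|) green n x y)).
  apply: le_trans (pr_exists pe01 (fun y => (k < hd x y)%N) _) _.
  apply: ler_sum => y _.
  apply: (@le_trans _ _ (pr pe (fun S => [exists n : 'I_#|V|, true && walk n set0 x y S]))).
    by apply: (le_pr pe01) => S /connect_walk[n nV w]; apply/existsP; exists (Ordinal nV).
  apply: le_trans (pr_exists pe01 predT (fun n : 'I_#|V| => walk n set0 x y)) _.
  by apply: ler_sum => n _; exact: pr_walk.
rewrite exchange_big /=.
apply: (@le_trans _ _ (\sum_(n < #|V|) lam ^- k * 2^-1 ^+ n)).
  apply: ler_sum => n _; rewrite ler_pdivlMl ?exprn_gt0 //.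
  apply: le_trans (sum_green n x); rewrite mulr_sumr [leRHS](bigID (fun y => (k < hd x y)%N)) /=.
  apply: ler_wpDr.
    by apply: sumr_ge0 => y _; rewrite mulr_ge0 ?exprn_ge0 ?(ltW lam0) ?green_ge0.
  apply: ler_sum => y ky; rewrite ler_wpM2r ?green_ge0 // ler_weXn2l //; exact: ltnW.
rewrite -mulr_sumr mulrC; apply: ler_wpM2r; first by rewrite invr_ge0 exprn_ge0 // ltW.
elim: #|V| => [|n IHn]; first by rewrite big_ord0.
have -> m : \sum_(i < m) 2^-1 ^+ i = 2 - 2 * 2^-1 ^+ m :> R.
  elim: m => [|m IHm]; first by rewrite big_ord0 expr0; ring.
  by rewrite big_ord_recr /= IHm exprS; field.
by rewrite gerBl mulr_ge0 // exprn_ge0 // invr_ge0.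
Qed.

End Subcritical.
End Probability.
End Graph.

(** * Escaping from balls *)

Section Escape.
Context {R : realType} {V : finType} {N K : nat} {hd : V -> V -> nat}.
Hypothesis uV : ultra N K hd.
Hypothesis N1 : (1 < N)%N.
Context (c : nat -> R) (pe : {set V} -> R).
Hypothesis c0 : forall j, (0 < j)%N -> 0 <= c j.
Hypothesis pe01 : forall e, 0 <= pe e <= 1.
Hypothesis peE : forall u v, u != v -> pe [set u; v] = @edgep R N c (hd u v).
Local Notation ball := (@ball V hd).

(** Centre and starting point are kept apart because uniqueness follows two starting points from one
    centre. *)
Definition escapes (o x : V) k (S : {set {set V}}) := [exists y, (k < hd o y)%N && connect (adj S) x y].

(** The terms decay with ratio 3/4, because c grows by at most 3/2 per step and N >= 2; the factor 3
    is the sum of (3/4)^i over i >= 1. This controls edges that jump over a long range of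
    distances. *)
Lemma tail_sum (k l M : nat) : (0 < k)%N -> (k <= l)%N ->
  (forall j, (k <= j)%N -> c j.+1 <= 3 / 2 * c j) ->
  N%:R ^+ k * \sum_(j < M | (l < j)%N) c j / N%:R ^+ j <= 3 * c k * (3 / 4) ^+ (l - k).
Proof.
move=> k0 kl hc; have Np := @N_gt0 R N N1.
have N2 : 2 <= N%:R :> R by rewrite ler_nat.
have ck0 := c0 k0; have q34 : 0 <= 3 / 4 :> R by lra.
have h i : N%:R ^+ k * (c (k + i)%N / N%:R ^+ (k + i)) <= c k * (3 / 4) ^+ i.
  have -> : N%:R ^+ k * (c (k + i)%N / N%:R ^+ (k + i)) = c (k + i)%N / N%:R ^+ i :> R.
    by rewrite exprD; field; rewrite !expf_neq0 // gt_eqF.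
  elim: i => [|i IHi]; first by rewrite addn0 !expr0 invr1 !mulr1.
  rewrite addnS !exprS invfM.
  have := hc (k + i)%N (leq_addr _ _); move: IHi.
  have : N%:R ^-1 <= 2^-1 :> R by rewrite lef_pV2 ?posrE.
  have : 0 < N%:R ^-1 :> R by rewrite invr_gt0.
  have ci0 : 0 <= c (k + i)%N by apply: c0; rewrite addn_gt0 k0.
  have ci1 : 0 <= c (k + i).+1 by apply: c0.
  move: (N%:R ^-1 : R) => n n0 n2 IHi hci.
  have ni0 : 0 <= (N%:R ^+ i)^-1 :> R by rewrite invr_ge0 exprn_ge0 ?ler0n.
  apply: (@le_trans _ _ ((3 / 2 * c (k + i)%N) * (2^-1 / N%:R ^+ i))).
    apply: ler_pM => //; first by rewrite mulr_ge0 // ltW.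
    by rewrite ler_wpM2r.
  have -> : 3 / 2 * c (k + i)%N * (2^-1 / N%:R ^+ i) = 3 / 4 * (c (k + i)%N / N%:R ^+ i) :> R.
    by field; rewrite expf_neq0 // gt_eqF.
  by rewrite [leRHS]mulrCA ler_wpM2l // divr_ge0.
rewrite mulr_sumr.
have [Ml|lM] := leqP M l.
  rewrite big_pred0 => [|j]; first by rewrite mulr_ge0 ?mulr_ge0 ?exprn_ge0.
  by apply/negbTE; rewrite -leqNgt ltnW // (leq_trans (ltn_ord j)).
rewrite -(big_mkord (fun j => (l < j)%N) (fun j => N%:R ^+ k * (c j / N%:R ^+ j))).
(* Subtracting the geometric remainder makes the bound provable by induction on M. *)
suff : \sum_(0 <= j < M | (l < j)%N) N%:R ^+ k * (c j / N%:R ^+ j) <=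
    3 * c k * ((3 / 4) ^+ (l - k) - (3 / 4) ^+ (M.-1 - k)).
  move/le_trans; apply; rewrite ler_wpM2l ?mulr_ge0 // gerBl.
  by rewrite exprn_ge0.
elim: M lM => [//|M IHM]; rewrite ltnS leq_eqVlt => /orP[/eqP <-|lM].
  rewrite /= big_nat_cond big_pred0 => [|j]; last by rewrite /= ltnS; case: leqP; rewrite ?andbF.
  by rewrite subrr mulr0.
rewrite big_mkcond big_nat_recr //= -big_mkcond lM; apply: le_trans (lerD (IHM lM) _) _.
  by have := h (M - k)%N; rewrite subnKC; [apply | rewrite (leq_trans kl) // ltnW].
case: M lM {IHM} => // M lM; rewrite [M.+1.-1]/= subSn ?exprS; last by rewrite (leq_trans kl).
by lra.
Qed.

(** Converse of 1 - p <= exp(-p) for small p, at the price of a factor 1 + tau: 1/(1-p) = 1 +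
    p/(1-p) <= exp(p/(1-p)), and here 1/(1-p) <= 1 + tau. *)
Lemma expR_lower (tau p : R) : 0 <= tau -> 0 <= p -> p <= tau / (1 + tau) ->
  expR (- ((1 + tau) * p)) <= 1 - p.
Proof.
move=> t0 p0 hp; have t1 : 0 < 1 + tau by lra.
have h : 1 <= (1 + tau) * (1 - p).
  by move: hp; rewrite ler_pdivlMr // => hp; lra.
have p1 : 0 < 1 - p by rewrite -(pmulr_rgt0 _ t1); lra.
rewrite expRN -[leRHS]invrK lef_pV2 ?posrE ?expR_gt0 ?invr_gt0 //.
apply: le_trans (_ : expR (p / (1 - p)) <= _).
  have {1}-> : (1 - p)^-1 = 1 + p / (1 - p) by field; rewrite gt_eqF.
  exact: expR_ge1Dx.
by rewrite ler_expR ler_pdivrMr // -mulrA mulrCA -[leLHS]mulr1 ler_wpM2l.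
Qed.

(** No edge joins the ball to the shell with probability at least exp(-(1+tau) m/N): each of the N^k
    points contributes the sum of m (N^j - N^(j-1)) / N^(2j) over j > k, which telescopes to at most
    m N^(-k-1). The remaining 1/N is the source of the threshold C_1 < N. *)
Lemma pr_shell o k l (m tau : R) : (k <= l)%N -> (l <= K)%N -> 0 <= tau ->
  (forall j, (k < j <= l)%N -> c j <= m) -> 0 <= m -> m / N%:R ^+ (2 * k) <= tau / (1 + tau) ->
  pr pe (joined (ball o k) (ball o l :\: ball o k)) <= 1 - expR (- ((1 + tau) * (m / N%:R))).
Proof.
move=> kl lK t0 cm m0 hm; have Np := @N_gt0 R N N1.
rewrite -[leLHS](subKr 1) lerD2l lerN2 -(prC pe) (pr_not_joined peE); last first.
  by rewrite -setI_eq0 setDE setICA setICr setI0.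
have sh u v : u \in ball o k -> v \in ball o l :\: ball o k -> (k < hd u v <= l)%N.
  move=> uk; rewrite !inE -(ltnNge k) => /andP[kv vl].
  move: uk kv vl; rewrite inE => uk kv vl; apply/andP; split.
    rewrite ltnNge; apply: contraL kv => uv; rewrite -leqNgt.
    by rewrite (leq_trans (hd_ultra uV u o v)) // geq_max uk.
  by rewrite (leq_trans (hd_ultra uV o u v)) // geq_max (hd_sym uV) vl (leq_trans uk).
have pd0 j : (0 < j)%N -> 0 <= @edgep R N c j.
  by move=> j0; rewrite le_min ler01 divr_ge0 ?exprn_ge0 ?ler0n ?c0.
have le1 j : (k < j <= l)%N -> @edgep R N c j <= m / N%:R ^+ (2 * j).
  move=> kj; apply: le_trans (edgep_le _ _) _; rewrite ler_wpM2r ?invr_ge0 ?exprn_ge0 ?ler0n //.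
  exact: cm.
apply: (@le_trans _ _ (\prod_(u in ball o k) expR (- ((1 + tau) * (m / N%:R ^+ k.+1))))).
  rewrite prodr_const (card_hd uV) ?(leq_trans kl) // -expRM_natl ler_expR.
  rewrite natrX mulrN lerN2 mulrCA ler_wpM2l ?addr_ge0 //.
  rewrite exprS le_eqVlt; apply/orP; left; apply/eqP.
  by field; rewrite expf_neq0 ?gt_eqF.
apply: ler_prod => u uk; rewrite expR_ge0 /=.
apply: (@le_trans _ _ (\prod_(v in ball o l :\: ball o k) expR (- ((1 + tau) * @edgep R N c (hd u v))))).
  rewrite -expR_sum ler_expR sumrN lerN2 -mulr_sumr ler_wpM2l ?addr_ge0 //.
  apply: (@le_trans _ _ (\sum_(v | (k < hd u v <= l)%N) m / N%:R ^+ (2 * hd u v))).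
    rewrite big_mkcond [leRHS]big_mkcond; apply: ler_sum => v _.
    case: ifP => [vB|_]; first by rewrite sh // le1 // sh.
    by case: ifP => // _; rewrite divr_ge0 ?exprn_ge0 ?ler0n.
  rewrite (sum_hd uV u (fun j => (k < j <= l)%N) (fun j => m / N%:R ^+ (2 * j))).
  rewrite -(big_mkord (fun j => (k < j <= l)%N)
     (fun j => #|[set v | hd u v == j]|%:R * (m / N%:R ^+ (2 * j)))).
  (* The term [maxn k i] absorbs the indices up to k, where nothing is summed. *)
  suff H i : (i <= K)%N -> \sum_(0 <= j < i.+1 | (k < j <= l)%N)
      #|[set v | hd u v == j]|%:R * (m / N%:R ^+ (2 * j)) <=
      m / N%:R * (N%:R ^- k - N%:R ^- maxn k i).
    apply: le_trans (H K (leqnn _)) _; rewrite exprS invfM mulrA ler_wpM2l ?divr_ge0 ?ler0n //.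
    by rewrite gerBl invr_ge0 exprn_ge0 ?ler0n.
  have mono x y : (x <= y)%N -> N%:R ^- y <= N%:R ^- x :> R.
    by move=> xy; rewrite lef_pV2 ?posrE ?exprn_gt0 // ler_weXn2l // ler1n ltnW.
  elim: i => [|i IHi] iK.
    by rewrite big_mkcond big_nat1 /= maxn0 subrr mulr0.
  rewrite big_mkcond big_nat_recr //= -big_mkcond /=.
  apply: le_trans (lerD (IHi (ltnW iK)) (lexx _)) _.
  case: ifP => [/andP[ki il]|_]; last first.
    rewrite addr0 ler_wpM2l ?divr_ge0 ?ler0n // lerD2l lerN2 mono //; lia.
  have -> : maxn k i = i by lia.
  have -> : maxn k i.+1 = i.+1 by lia.
  rewrite (card_sphere uV) // natrB ?leq_exp2l // !natrX.
  rewrite mul2n -addnn exprD exprS le_eqVlt; apply/orP; left; apply/eqP.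
  by field; rewrite ?expf_neq0 ?gt_eqF.
apply: ler_prod => v vB; rewrite expR_ge0 /=; have /andP[kv vl] := sh u v uk vB.
apply: expR_lower => //; first by rewrite pd0 // (leq_ltn_trans _ kv).
apply: le_trans (le1 _ _) _; first by rewrite kv.
apply: le_trans hm; rewrite ler_wpM2l // lef_pV2 ?posrE ?exprn_gt0 // ler_weXn2l //.
  by rewrite ler1n ltnW.
by rewrite leq_mul2l /= ltnW.
Qed.

Lemma connect_joined (S : {set {set V}}) (x y : V) (A : {set V}) : x \in A -> y \notin A -> connect (adj S) x y ->
  exists u v, [/\ u \in A, connect (adj S) x u, v \notin A & adj S u v].
Proof.
move=> xA yA /connectP[p pp ey]; elim: p x xA pp ey => [|z p IHp] x xA /=.
  by move=> _ ey; rewrite ey xA in yA.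
case/andP=> xz pz ey; have [zA|zA] := boolP (z \in A); last by exists x, z; rewrite connect0.
have [u [v [uA zu vA uv]]] := IHp z zA pz ey; exists u, v; split=> //.
exact: connect_trans (connect1 xz) zu.
Qed.

(** To leave the last ball a path must either use an edge that jumps from one ball past the next, or
    use an edge into every shell. Jumps are bounded by a union bound; the shells are treated one
    after another by [pr_chain], as edges inside a ball do not affect its shell event. *)
Lemma pr_escape_levels o (l : nat -> nat) n (q e : R) :
  (forall i, (i < n)%N -> l i < l i.+1)%N -> (l n <= K)%N -> 0 <= q ->
  (forall i, (i < n)%N ->
     N%:R ^+ l i * \sum_(j < K.+1 | (l i.+1 < j)%N) c j / N%:R ^+ j <= e) ->
  (forall i, (i < n)%N ->
    pr pe (joined (ball o (l i)) (ball o (l i.+1) :\: ball o (l i))) <= q) ->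
  pr pe (escapes o o (l n)) <= n%:R * e + q ^+ n.
Proof.
move=> lS lK q0 he hq.
have lmono i j : (i <= j)%N -> (j <= n)%N -> (l i <= l j)%N.
  elim: j => [|j IHj]; first by case: i.
  rewrite leq_eqVlt => /orP[/eqP -> //|ij jn].
  exact: leq_trans (IHj ij (ltnW jn)) (ltnW (lS _ jn)).
pose B i := ball o (l i).
pose F i := joined (B i) (~: B i.+1).
pose W i := joined (B i) (B i.+1 :\: B i).
apply: (@le_trans _ _ (pr pe (predU (fun S => has (F^~ S) (iota 0 n))
                                   (fun S => all (W^~ S) (iota 0 n))))).
  apply: (le_pr pe01) => S /existsP[y /andP[ky xy]] /=.
  case: (boolP (has _ _)) => //= /hasPn nF; apply/allP => i; rewrite mem_iota add0n => /andP[_ i_n].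
  have := @connect_joined S o y (B i) (ball_refl uV _ _) _ xy.
  case; first by rewrite inE -ltnNge (leq_ltn_trans _ ky) // lmono // ltnW.
  move=> u [v [uB _ vB uv]]; apply/joinedP; exists u, v; split=> //.
  rewrite inE vB /=; apply: contraT => vB'.
  have := nF i; rewrite mem_iota add0n i_n => /(_ isT)/negP[].
  by apply/joinedP; exists u, v; split; rewrite ?in_setC.
apply: (le_trans (prU pe01 _ _)); apply: lerD.
  apply: le_trans (prU_seq pe01 _ _) _; rewrite -[n in n%:R]card_ord mulr_natl -sumr_const.
  apply: ler_sum => i _; apply: le_trans (he i (ltn_ord i)).
  have -> : N%:R ^+ l i = #|B i|%:R :> R.
    by rewrite (card_hd uV) ?natrX // (leq_trans _ lK) // lmono // ltnW.
  apply: (pr_joined_out uV N1 c0 pe01 peE) => u v uB; rewrite inE => vB.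
  rewrite ltnNge; apply: contra vB => uv; rewrite inE.
  rewrite (leq_trans (hd_ultra uV u o v)) // geq_max uv andbT.
  by move: uB; rewrite inE => /leq_trans; apply; rewrite ltnW // lS.
apply: (@pr_chain _ _ _ pe01 (fun i => edges (B i) (B i))) => // i.
- by move=> i_n; apply: edgesS; apply: ball_sub; rewrite ltnW // lS.
- move=> i_n; apply: dep_joined; first by apply: ball_sub; rewrite ltnW // lS.
  by apply/subsetP => v; rewrite inE => /andP[].
- move=> A i_n; apply: le_trans (hq i i_n); apply: (le_pr pe01) => S.
  rewrite /W joined_mix //.
  by rewrite -setI_eq0 setDE -setIA [X in _ :&: X]setIC setICr setI0.
Qed.

End Escape.

(** * Logarithmic connection rates *)

Section Log.
Context {R : realType}.

Lemma nat_upper (s : seq R) : exists m : nat, all (fun x => x <= m%:R) s.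
Proof.
exists (Num.bound (\sum_(x <- s) `|x|)); apply/allP => x xs.
apply: le_trans (ltW (archi_boundP _)); last by apply: sumr_ge0.
by rewrite (big_rem x) //= (le_trans (ler_norm x)) // lerDl sumr_ge0.
Qed.

Lemma ln_ge0N (j : nat) : 0 <= ln j%:R :> R.
Proof. by case: j => [|j]; [rewrite ln0 | rewrite ln_ge0 // ler1n]. Qed.

Lemma ln_nat_mono (i j : nat) : (i <= j)%N -> ln i%:R <= ln j%:R :> R.
Proof.
case: i => [|i] ij; first by rewrite ln0 ?ln_ge0N.
by rewrite ler_ln ?posrE ?ltr0n ?ler_nat ?(leq_trans _ ij).
Qed.

(** The growth condition of [tail_sum] for the logarithm, from (j+1)^2 <= j^3 for j >= 3. *)
Lemma ln_succ_le (j : nat) : (3 <= j)%N -> ln j.+1%:R <= 3 / 2 * ln j%:R :> R.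
Proof.
move=> j3; have jp : 0 < j%:R :> R by rewrite ltr0n; lia.
have : ln (j.+1%:R ^+ 2) <= ln (j%:R ^+ 3) :> R.
  rewrite ler_ln ?posrE ?exprn_gt0 ?jp ?ltr0n // -!natrX ler_nat.
  by rewrite !expnS expn0 !muln1; nia.
by rewrite !lnXn ?ltr0n -?(ltr0n R) // => h; lra.
Qed.

(** The bound ln y < y at y = eta x; the slope eta can be as small as desired. *)
Lemma ln_linear (eta x : R) : 0 < eta -> 0 < x -> ln x <= eta * x - ln eta.
Proof.
move=> e0 x0; have := ltW (ln_sublinear (mulr_gt0 e0 x0)).
by rewrite lnM ?posrE //; lra.
Qed.

Lemma bernoulli_le (x : R) n : 0 <= x -> 1 + n%:R * x <= (1 + x) ^+ n.
Proof.
move=> x0; elim: n => [|n IHn]; first by rewrite expr0 mul0r addr0.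
rewrite exprS; apply: (@le_trans _ _ ((1 + x) * (1 + n%:R * x))).
  by rewrite -natr1; have : 0 <= n%:R * x * x; [rewrite !mulr_ge0 // ler0n | lra].
by rewrite ler_wpM2l // addr_ge0.
Qed.

(** Since 2 (3/4)^4 (5/4)^2 < 1 and (5/4)^m >= m/4. It bounds the jumps over 2^m levels with gaps
    4m, the factor m standing for the logarithmic rate at these radii. *)
Lemma expr_ratio (m : nat) : (0 < m)%N ->
  2 ^+ m * (3 / 4) ^+ (4 * m) * m%:R <= 16 / m%:R :> R.
Proof.
move=> m0; have mp : 0 < m%:R :> R by rewrite ltr0n.
have q4 : 0 <= 3 / 4 :> R by lra.
have h : m%:R / 4 <= (5 / 4) ^+ m :> R.
  have -> : 5 / 4 = 1 + 4^-1 :> R by field.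
  by apply: le_trans (bernoulli_le _ _); rewrite ?invr_ge0 ?ler0n // lerDr.
have h2 : 2 ^+ m * (3 / 4) ^+ (4 * m) * ((5 / 4) ^+ m * (5 / 4) ^+ m) <= 1 :> R.
  rewrite exprM -!exprMn exprn_ile1 //; first by rewrite ?mulr_ge0 ?exprn_ge0 //; lra.
  by rewrite !exprS expr0; lra.
rewrite ler_pdivlMr //; apply: (@le_trans _ _ (16 * (2 ^+ m * (3 / 4) ^+ (4 * m) * ((5 / 4) ^+ m * (5 / 4) ^+ m)))); last by lra.
have : m%:R / 4 * (m%:R / 4) <= (5 / 4) ^+ m * (5 / 4) ^+ m :> R by apply: ler_pM => //; lra.
have : 0 <= 2 ^+ m * (3 / 4) ^+ (4 * m) :> R by rewrite mulr_ge0 ?exprn_ge0.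
set x := 2 ^+ m * _; set y := (5 / 4) ^+ m * _ => x0 xy.
have : x * (m%:R / 4 * (m%:R / 4)) <= x * y by rewrite ler_wpM2l.
lra.
Qed.

Lemma escape_log (N : nat) (N1 : (1 < N)%N) (C0 C1 : R) (c : nat -> R) (delta : R) :
  0 <= C0 -> 0 <= C1 -> C1 < N%:R -> (forall j, c j = C0 + C1 * ln j%:R) -> 0 < delta ->
  exists k, forall K (V : finType) (hd : V -> V -> nat) (pe : {set V} -> R) (o : V),
    (k <= K)%N -> ultra N K hd -> (forall e, 0 <= pe e <= 1) ->
    (forall u v, u != v -> pe [set u; v] = @edgep R N c (hd u v)) ->
    pr pe (@escapes V hd o o k) <= delta.
Proof.
move=> C00 C10 C1N hc d0; have Np := @N_gt0 R N N1.
have N2 : 2 <= N%:R :> R by rewrite ler_nat.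
(* The slack lost in [pr_shell] is half the relative gap (N - C_1)/N, small enough for the exponent
   [theta] to stay below 1. *)
pose tau := (N%:R - C1) / (2 * N%:R); have t0 : 0 < tau by rewrite divr_gt0 ?mulr_gt0 //; lra.
pose theta := (1 + tau) * C1 / N%:R.
have th0 : 0 <= theta by rewrite divr_ge0 ?mulr_ge0 //; lra.
have th1 : theta < 1.
  rewrite ltr_pdivrMr // mul1r /tau -subr_gt0.
  have -> : N%:R - (1 + (N%:R - C1) / (2 * N%:R)) * C1 =
    (N%:R - C1) * (2 * N%:R - C1) / (2 * N%:R) by field; rewrite gt_eqF.
  by rewrite divr_gt0 ?mulr_gt0 //; lra.
have l2 : 0 < ln 2 :> R by rewrite ln_gt0 // ltr1n.
(* Half of the rate (1 - theta) ln 2 is kept as a; the other half, through eta = a/8, pays for the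
   term ln(8m). *)
pose a := (1 - theta) * ln 2 / 2; have a0 : 0 < a by rewrite divr_gt0 ?mulr_gt0 //; lra.
pose eta := a / 8; have e0 : 0 < eta by rewrite divr_gt0.
pose b := (1 + tau) * C0 / N%:R - ln eta.
(* After m >= 1, the bounds on m ensure in turn: edge probabilities small enough for [pr_shell];
   probability at most delta/2 that all shells are crossed; probability at most delta/2 that some
   edge jumps past a level. *)
have [m /= /and5P[m1 m2 m3 m4 _]] := nat_upper [:: 1; (C0 + 9 * C1) * (1 + tau) / tau;
  (b + 2 / delta) / a; 96 * (C0 + 9 * C1) / delta].
have m0 : (0 < m)%N by rewrite -(ltr0n R) (lt_le_trans ltr01).
have mp : 0 < m%:R :> R by rewrite ltr0n.
pose l i := (4 * m * (2 ^ m + i))%N.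
have lS i : (l i < l i.+1)%N by rewrite ltn_mul2l muln_gt0 m0 ltn_add2l ltnS leqnn.
pose M := C0 + C1 * ln (l (2 ^ m)%N)%:R.
have lm : ln (l (2 ^ m)%N)%:R = ln (8 * m%:R) + m%:R * ln 2 :> R.
  have -> : (l (2 ^ m)%N)%:R = (8 * m%:R) * 2 ^+ m :> R.
    by rewrite /l !natrM natrD natrX; ring.
  by rewrite lnM ?posrE ?mulr_gt0 ?exprn_gt0 // lnXn // [m%:R * _]mulr_natl.
have M9 : M <= (C0 + 9 * C1) * m%:R.
  have h8 : ln (8 * m%:R) <= 8 * m%:R :> R by apply: ltW; apply: ln_sublinear; rewrite mulr_gt0.
  have h2 : ln 2 <= 1 :> R by have := @le_ln1Dx R 1; rewrite (_ : 1 + 1 = 2) //; apply; lra.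
  have : C1 * ln (l (2 ^ m)%N)%:R <= C1 * (9 * m%:R).
    rewrite ler_wpM2l // lm; have : m%:R * ln 2 <= m%:R :> R by rewrite ger_pMr.
    lra.
  move=> hl; have hc0 : C0 <= C0 * m%:R by rewrite ler_peMr.
  rewrite /M; lra.
have M0 : 0 <= M by rewrite addr_ge0 ?mulr_ge0 // ln_ge0N.
have cM j : (j <= l (2 ^ m))%N -> c j <= M.
  by move=> jl; rewrite hc lerD2l ler_wpM2l // ln_nat_mono.
have c0 j : 0 <= c j by rewrite hc addr_ge0 ?mulr_ge0 // ln_ge0N.
have lle i : (i <= 2 ^ m)%N -> (l i <= l (2 ^ m))%N by move=> im; rewrite leq_mul2l leq_add2l im orbT.
exists (l (2 ^ m)%N) => K V hd pe o kK uV pe01 peE.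
pose q := 1 - expR (- ((1 + tau) * (M / N%:R))).
have q0 : 0 <= q.
  rewrite subr_ge0 -[leRHS]expR0 ler_expR oppr_le0 mulr_ge0 ?divr_ge0 ?ler0n //; lra.
have l4 i : (4 * m <= l i)%N by rewrite leq_pmulr // addn_gt0 expn_gt0.
have lbig i : (m < l i)%N by apply: leq_trans (l4 i); rewrite -{1}[m]mul1n ltn_mul2r m0.
have pw i : M / N%:R ^+ (2 * l i) <= tau / (1 + tau).
  have p2 : m%:R * m%:R <= N%:R ^+ (2 * l i) :> R.
    rewrite -natrM -natrX ler_nat mul2n -addnn expnD.
    have h : (m < N ^ l i)%N by rewrite (ltn_trans (lbig i)) // ltn_expl.
    by rewrite leq_mul // ltnW.
  have t1 : 0 < 1 + tau by lra.
  rewrite ler_pdivrMr ?exprn_gt0 //; apply: le_trans M9 _.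
  apply: (@le_trans _ _ (tau / (1 + tau) * (m%:R * m%:R))); last first.
    by rewrite ler_wpM2l // divr_ge0 ?ltW.
  rewrite mulrA ler_wpM2r ?(ltW mp) // mulrAC ler_pdivlMr //.
  by move: m2; rewrite ler_pdivrMr // [X in _ <= X -> _]mulrC.
pose e := 3 * M * (3 / 4) ^+ (4 * m).
have := @pr_escape_levels R V N K hd uV N1 c pe (fun j _ => c0 j) pe01 peE o l (2 ^ m) q e.
move=> /(_ (fun i _ => lS i) kK q0) h; apply: le_trans (h _ _) _; rewrite {h}.
- move=> i im; apply: le_trans (tail_sum N1 (fun j _ => c0 j) _ _ (ltnW (lS i)) _) _.
  + exact: leq_ltn_trans (lbig i).
  + move=> j lj; rewrite !hc; have j3 : (3 <= j)%N.
      by apply: leq_trans lj; apply: leq_trans (l4 _); exact: leq_trans (leq_mul (leqnn 4) m0).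
    have := ler_wpM2l C10 (ln_succ_le j3); lra.
  + have -> : (l i.+1 - l i = 4 * m)%N by rewrite -mulnBr addnS subSn // subnn muln1.
    rewrite ler_wpM2r ?exprn_ge0 //; first by lra.
    by rewrite ler_wpM2l // cM // lle // ltnW.
- move=> i im; apply: (pr_shell uV N1 (fun j _ => c0 j) peE) => //.
  + exact: ltnW.
  + by apply: leq_trans kK; exact: lle.
  + exact: ltW.
  + by move=> j /andP[_ jl]; apply: cM; apply: leq_trans jl _; exact: lle.
have -> : delta = delta / 2 + delta / 2 by lra.
apply: lerD.
  rewrite /e natrX; apply: (@le_trans _ _ (3 * (C0 + 9 * C1) *
     (2 ^+ m * (3 / 4) ^+ (4 * m) * m%:R))).
    have : 2 ^+ m * (3 / 4) ^+ (4 * m) * M <= 2 ^+ m * (3 / 4) ^+ (4 * m) * ((C0 + 9 * C1) * m%:R).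
      rewrite ler_wpM2l // mulr_ge0 ?exprn_ge0 //; lra.
    lra.
  apply: le_trans (ler_wpM2l _ (expr_ratio m0)) _; first by rewrite mulr_ge0 //; lra.
  by rewrite mulrA ler_pdivrMr //; move: m4; rewrite ler_pdivrMr //; lra.
have qe : q <= expR (- expR (- ((1 + tau) * (M / N%:R)))).
  exact: expR_ge1Dx.
apply: (@le_trans _ _ (expR (- expR (- ((1 + tau) * (M / N%:R)))) ^+ (2 ^ m))).
  by apply: lerXn2r => //; rewrite nnegrE ?expR_ge0.
rewrite -expRM_natl mulrN expRN natrX.
(* A lower bound for the mean number of empty shells: there are 2^m of them, each empty with
   probability at least a constant times (8m 2^m)^(-theta). *)
have P2 : 2 ^+ m * expR (- ((1 + tau) * (M / N%:R))) >= 2 / delta.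
  have -> : 2 ^+ m = expR (m%:R * ln 2) :> R by rewrite expRM_natl lnK ?posrE.
  rewrite -expRD; apply: (@le_trans _ _ (1 + (a * m%:R - b))); last first.
    apply: le_trans (expR_ge1Dx _) _; rewrite ler_expR.
    have -> : (1 + tau) * (M / N%:R) = (1 + tau) * C0 / N%:R + theta * ln (l (2 ^ m)%N)%:R.
      by rewrite /M /theta; field; rewrite gt_eqF.
    rewrite lm /b; have l8 : 0 <= ln (8 * m%:R) :> R by rewrite -natrM ln_ge0N.
    have lin : ln (8 * m%:R) <= eta * (8 * m%:R) - ln eta by apply: ln_linear => //; apply: mulr_gt0.
    have : theta * ln (8 * m%:R) <= ln (8 * m%:R) by rewrite -[leRHS]mul1r ler_wpM2r // ltW.
    by move: lin; rewrite /eta /a; lra.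
  move: m3; rewrite ler_pdivrMr //; lra.
rewrite -[delta / 2]invrK lef_pV2 ?posrE ?expR_gt0 ?invr_gt0 ?divr_gt0 // invf_div.
apply: le_trans P2 _; apply: le_trans (expR_ge1Dx _); lra.
Qed.

End Log.

(** * Growth of the connection rates *)

Section Growth.
Context {R : realType}.

Lemma powR_expR (alpha x : R) : 0 < x -> x `^ alpha = expR (alpha * ln x).
Proof. by move=> x0; rewrite /powR gt_eqF. Qed.

(** Exponentiate [ln_linear] with slope ln(rho)/alpha. *)
Lemma powR_le_expr (alpha rho : R) : 0 < alpha -> 1 < rho ->
  exists2 H : R, 0 < H & forall j : nat, (0 < j)%N -> j%:R `^ alpha <= H * rho ^+ j.
Proof.
move=> a0 r1; have lr : 0 < ln rho by rewrite ln_gt0.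
pose eta := ln rho / alpha; have e0 : 0 < eta by rewrite divr_gt0.
exists (expR (- (alpha * ln eta))) => [|j j0]; first exact: expR_gt0.
have jp : 0 < j%:R :> R by rewrite ltr0n.
have rp : 0 < rho by apply: lt_trans r1.
rewrite powR_expR // -[in leRHS](lnK rp) -expRM_natl -expRD ler_expR.
have := ler_wpM2l (ltW a0) (ln_linear e0 jp); move/le_trans; apply.
rewrite mulrBr addrC lerD2l mulrA /eta mulrCA divff ?gt_eqF // mulr1 mulrC.
by [].
Qed.

Lemma sum_geo_le (r : R) n : 0 <= r -> r < 1 -> \sum_(j < n) r ^+ j <= (1 - r)^-1.
Proof.
move=> r0 r1; have q : 0 < 1 - r by rewrite subr_gt0.
rewrite -[leRHS]mul1r ler_pdivlMr //.
have -> : (\sum_(j < n) r ^+ j) * (1 - r) = 1 - r ^+ n.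
  elim: n => [|n IHn]; first by rewrite big_ord0 expr0 mul0r subrr.
  by rewrite big_ord_recr /= mulrDl IHn exprS; ring.
by rewrite gerBl exprn_ge0.
Qed.

Lemma ck_ge0 (C0 C1 C2 alpha : R) j : 0 <= C0 -> 0 <= C1 -> 0 <= C2 ->
  0 <= ck C0 C1 C2 alpha j.
Proof. by move=> *; rewrite !addr_ge0 ?mulr_ge0 ?powR_ge0 ?ln_ge0N. Qed.

(** The walk estimate with lam = 9/8. For small constants c_j <= (1/6)(9/8)^j, so the weighted terms
    are at most (1/6)(81/128)^j as N >= 2, and their sum is at most (1/6)(128/47) < 1/2. *)
Lemma escape_small (N : nat) (alpha : R) : (1 < N)%N -> 1 <= alpha ->
  exists2 Cs : R, 0 < Cs & forall C0 C1 C2 : R, 0 <= C0 -> 0 <= C1 -> 0 <= C2 ->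
    C0 < Cs -> C1 < Cs -> C2 < Cs -> forall delta : R, 0 < delta ->
  exists k, forall K (V : finType) (hd : V -> V -> nat) (pe : {set V} -> R) (o : V),
    ultra N K hd -> (forall e, 0 <= pe e <= 1) ->
    (forall u v, u != v -> pe [set u; v] = @edgep R N (ck C0 C1 C2 alpha) (hd u v)) ->
    pr pe (@escapes V hd o o k) <= delta.
Proof.
move=> N1 a1; have a0 : 0 < alpha by apply: lt_le_trans a1.
have N2 : 2 <= N%:R :> R by rewrite ler_nat.
have [|H H0 hH] := @powR_le_expr alpha (9 / 8) a0; first by lra.
(* Each of the three terms of c_j is then at most j^alpha / (18 H), together at most (9/8)^j / 6. *)
exists (18 * H)^-1 => [|C0 C1 C2 C00 C10 C20 h0 h1 h2 delta d0]; first by rewrite invr_gt0 mulr_gt0.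
(* By the Bernoulli inequality (9/8)^k >= 1 + k/8 >= 2/delta. *)
have [k /= /andP[kd _]] := nat_upper [:: 16 / delta].
exists k => K V hd pe o uV pe01 peE.
apply: le_trans (pr_connect_far uV N1 _ pe01 peE (_ : 1 <= 9 / 8) _ o k) _.
- by move=> j _; exact: ck_ge0.
- by lra.
- have r0 : 0 <= 9 / 8 / N%:R :> R by rewrite divr_ge0 ?ler0n //; lra.
  apply: (@le_trans _ _ (\sum_(j < K.+1) 6^-1 * (81 / 128) ^+ j)); last first.
    have g : \sum_(j < K.+1) (81 / 128) ^+ j <= 128 / 47 :> R.
      have -> : 128 / 47 = (1 - 81 / 128)^-1 :> R by field.
      by apply: sum_geo_le; lra.
    by rewrite -mulr_sumr; lra.
  rewrite big_mkcond; apply: ler_sum => j _; case: ifP => j0; last first.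
    by rewrite mulr_ge0 ?invr_ge0 ?ler0n ?exprn_ge0 //; lra.
  have jp : 0 < (j : nat)%:R :> R by rewrite ltr0n.
  have j1 : 1 <= (j : nat)%:R :> R by rewrite ler1n.
  have pa : (j : nat)%:R <= (j : nat)%:R `^ alpha :> R.
    by rewrite -[leLHS]powRr1 ?ler0n // ler_powR.
  have lj : ln (j : nat)%:R <= (j : nat)%:R `^ alpha :> R.
    by apply: le_trans pa; apply: ltW; apply: ln_sublinear.
  have cj : ck C0 C1 C2 alpha j <= 6^-1 * (9 / 8) ^+ j.
    apply: (@le_trans _ _ (3 * (18 * H)^-1 * (j : nat)%:R `^ alpha)).
      rewrite /ck; set y := _ `^ _ in pa lj *; set i := (18 * H)^-1 in h0 h1 h2 *.
      have i0 : 0 <= i by rewrite invr_ge0 mulr_ge0 // ltW.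
      have : C0 * 1 <= i * y by apply: ler_pM => //; [exact: ltW | exact: le_trans pa].
      have : C1 * ln (j : nat)%:R <= i * y by apply: ler_pM => //; rewrite ?ln_ge0N // ltW.
      have : C2 * y <= i * y by rewrite ler_wpM2r ?ltW //; exact: lt_le_trans pa.
      lra.
    apply: le_trans (ler_wpM2l _ (hH j j0)) _.
      by rewrite mulr_ge0 // invr_ge0 mulr_ge0 // ltW.
    rewrite mulrA (_ : 3 * (18 * H)^-1 * H = 6^-1) //.
    by field; rewrite gt_eqF.
  apply: le_trans (ler_wpM2r (exprn_ge0 _ r0) cj) _.
  apply: (@le_trans _ _ (6^-1 * (9 / 8 * (9 / 8 / N%:R)) ^+ j)); first by rewrite [X in _ <= _ * X]exprMn mulrA.
  apply: ler_wpM2l; first by rewrite invr_ge0.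
  have r8 : 0 <= 9 / 8 :> R by lra.
  apply: lerXn2r; rewrite ?nnegrE ?mulr_ge0 ?invr_ge0 ?ler0n //.
  have : 9 / 8 / N%:R <= 9 / 8 / 2 :> R.
    by rewrite ler_wpM2l // lef_pV2 ?posrE ?(lt_le_trans _ N2).
  lra.
have : 1 + k%:R * 8^-1 <= (9 / 8) ^+ k :> R.
  have -> : 9 / 8 = 1 + 8^-1 :> R by field.
  by apply: bernoulli_le; rewrite invr_ge0 ler0n.
move=> hb; have p98 : 0 < (9 / 8) ^+ k :> R by rewrite exprn_gt0 //; lra.
rewrite ler_pdivrMr //; move: kd; rewrite ler_pdivrMr // => kd.
by have := ler_wpM2l (ltW d0) hb; lra.
Qed.

Lemma ck_mono (C0 C1 C2 alpha : R) i j : 0 <= C1 -> 0 <= C2 -> 0 <= alpha ->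
  (0 < i)%N -> (i <= j)%N -> ck C0 C1 C2 alpha i <= ck C0 C1 C2 alpha j.
Proof.
move=> C10 C20 a0 i0 ij; rewrite /ck lerD ?lerD2l ?ler_wpM2l ?ln_nat_mono //.
by apply: ge0_ler_powR => //; rewrite ?nnegrE ?ler0n ?ler_nat.
Qed.

(** The growth condition of [tail_sum]: (1 + 1/j)^alpha <= exp(alpha/j) <= 3/2 for j >= alpha /
    ln(3/2). *)
Lemma ck_ratio (C0 C1 C2 alpha : R) : 0 <= C0 -> 0 <= C1 -> 0 <= C2 -> 0 <= alpha ->
  exists k, forall j, (k <= j)%N ->
    ck C0 C1 C2 alpha j.+1 <= 3 / 2 * ck C0 C1 C2 alpha j.
Proof.
move=> C00 C10 C20 a0; have l32 : 0 < ln (3 / 2) :> R by rewrite ln_gt0 //; lra.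
have [k /= /andP[kd _]] := nat_upper [:: alpha / ln (3 / 2)].
exists (maxn 3 k) => j; rewrite geq_max => /andP[j3 kj].
have jp : 0 < j%:R :> R by rewrite ltr0n; lia.
have hp : j.+1%:R `^ alpha <= 3 / 2 * j%:R `^ alpha :> R.
  have -> : j.+1%:R = (1 + j%:R^-1) * j%:R :> R by rewrite mulrDl mul1r mulVf ?gt_eqF // natr1.
  have j0 : 0 < j%:R^-1 :> R by rewrite invr_gt0.
  rewrite powRM ?ler0n ?addr_ge0 ?(ltW j0) // ler_wpM2r ?powR_ge0 //.
  rewrite powR_expR ?addr_gt0 // -[leRHS]lnK ?posrE; last by lra.
  rewrite ler_expR; apply: (@le_trans _ _ (alpha * j%:R^-1)).
    by rewrite ler_wpM2l // le_ln1Dx // (lt_trans _ j0) // ltrN10.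
  rewrite ler_pdivrMr //; move: kd; rewrite ler_pdivrMr // => /le_trans; apply.
  by rewrite mulrC ler_wpM2l ?ler_nat // ltW.
have := ler_wpM2l C10 (ln_succ_le (R := R) j3).
have := ler_wpM2l C20 hp.
rewrite /ck; lra.
Qed.

End Growth.

(** * Giants *)

Section Giants.
Context {R : realType} {V : finType} {N K : nat} {hd : V -> V -> nat}.
Hypothesis uV : ultra N K hd.
Hypothesis N1 : (1 < N)%N.
Context (c : nat -> R) (pe : {set V} -> R).
Hypothesis c0 : forall j, (0 < j)%N -> 0 <= c j.
Hypothesis pe01 : forall e, 0 <= pe e <= 1.
Hypothesis peE : forall u v, u != v -> pe [set u; v] = @edgep R N c (hd u v).
Context (ks : nat -> nat).
Hypothesis ks0 : ks 0 = 0%N.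
Hypothesis ksS : forall n, (ks n < ks n.+1)%N.
Local Notation ball := (@ball V hd).
Implicit Types (S T J : {set {set V}}) (A B : {set V}) (u v w a b : V).

Lemma ks_mono m n : (m <= n)%N -> (ks m <= ks n)%N.
Proof.
elim: n => [|n IHn]; first by case: m.
rewrite leq_eqVlt => /orP[/eqP -> //|mn]; exact: leq_trans (IHn mn) (ltnW (ksS n)).
Qed.

(* First component: the ball of radius [ks n] around v is good; second: v lies in the giant
   of every good ball of smaller scale around it. *)
Fixpoint good_inner n S v : bool * bool :=
  if n is m.+1 then
    ([forall u in ball v (ks m.+1), forall w in ball v (ks m.+1), (ks m < hd u w)%N ==>
        ((good_inner m S u).1 || (good_inner m S w).1) &&
        ((good_inner m S u).1 && (good_inner m S w).1 ==>
           joined [set a in ball u (ks m) | (good_inner m S a).2] [set a in ball w (ks m) | (good_inner m S a).2] S)],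
     (good_inner m S v).1 && (good_inner m S v).2)
  else (true, true).

Definition good n v S := (good_inner n S v).1.
Definition inner n v S := (good_inner n S v).2.
(** By [innerS], the giant at scale n+1 is the union of the giants of the good sub-balls of scale
    n. *)
Definition giant n v S : {set V} := [set a in ball v (ks n) | inner n a S].

Lemma innerS n v S : inner n.+1 v S = good n v S && inner n v S.
Proof. by []. Qed.

(** Points at distance above [ks n] lie in different sub-balls, so asking that one of any two such
    sub-balls be good allows at most one bad sub-ball. *)
Lemma goodP n v S : reflect (forall u w, u \in ball v (ks n.+1) -> w \in ball v (ks n.+1) ->
   (ks n < hd u w)%N -> (good n u S || good n w S) /\
   (good n u S -> good n w S -> joined (giant n u S) (giant n w S) S)) (good n.+1 v S).
Proof.
apply: (iffP forall_inP) => [h u w uv wv uw|h u uv].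
  have /forall_inP/(_ w wv)/implyP/(_ uw)/andP[h1 /implyP h2] := h u uv.
  by split=> // gu gw; apply: h2; apply/andP; split.
apply/forall_inP => w wv; apply/implyP => uw; have [h1 h2] := h u w uv wv uw.
by apply/andP; split=> //; apply/implyP => /andP[]; exact: h2.
Qed.

Lemma hd_swap u v k : (u \in ball v k) = (v \in ball u k).
Proof. by rewrite !inE (hd_sym uV). Qed.

Lemma ball_trans u v w k l : u \in ball v l -> w \in ball u k -> (k <= l)%N -> w \in ball v l.
Proof. by move=> uv wu kl; rewrite (ballE uV uv); apply: (subsetP (ball_sub _ kl)). Qed.

(** Goodness and inner points are read off the edges inside the ball, which makes distinct balls of
    one scale independent. *)
Lemma good_inner_local n S T v :
  (forall a b, a \in ball v (ks n) -> b \in ball v (ks n) -> adj S a b = adj T a b) ->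
  good_inner n S v = good_inner n T v.
Proof.
elim: n v => [//|n IHn] v h /=.
have hu u : u \in ball v (ks n.+1) -> good_inner n S u = good_inner n T u.
  move=> uv; apply: IHn => a b au bu.
  by apply: h; [exact: ball_trans uv au (ltnW (ksS n)) | exact: ball_trans uv bu (ltnW (ksS n))].
have hs u : u \in ball v (ks n.+1) ->
    [set a in ball u (ks n) | (good_inner n S a).2] = [set a in ball u (ks n) | (good_inner n T a).2].
  move=> uv; apply/setP => a; rewrite [LHS]inE [RHS]inE; case: (boolP (a \in ball u _)) => //= au.
  by rewrite hu //; exact: ball_trans uv au (ltnW (ksS n)).
congr (_, _); last by rewrite hu // (ball_refl uV).
apply: eq_forallb_in => u uv; apply: eq_forallb_in => w wv.
rewrite !hu // !hs //; case: (ltnP (ks n) (hd u w)) => //= uw; congr (_ && (_ ==> _)).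
apply: eq_joined => a b; rewrite !inE => /andP[au _] /andP[bw _].
apply: h; [apply: (ball_trans uv _ (ltnW (ksS n))) | apply: (ball_trans wv _ (ltnW (ksS n)))];
  by rewrite inE.
Qed.

Lemma good_local n S T v :
  (forall a b, a \in ball v (ks n) -> b \in ball v (ks n) -> adj S a b = adj T a b) ->
  good n v S = good n v T.
Proof. by move=> h; rewrite /good (good_inner_local h). Qed.

Lemma giant_local n S T v :
  (forall a b, a \in ball v (ks n) -> b \in ball v (ks n) -> adj S a b = adj T a b) ->
  giant n v S = giant n v T.
Proof.
move=> h; apply/setP => a; rewrite [LHS]inE [RHS]inE /inner.
case: (boolP (a \in ball v _)) => //= av; rewrite (@good_inner_local n S T) // -(ballE uV av); exact: h.
Qed.

Lemma good_ball n S u v : u \in ball v (ks n) -> good n u S = good n v S.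
Proof. by case: n => [//|n] uv; rewrite /good /= (ballE uV uv). Qed.

Lemma giant_ball n S u v : u \in ball v (ks n) -> giant n u S = giant n v S.
Proof. by move=> uv; rewrite /giant (ballE uV uv). Qed.

Lemma dep_good n v B : ball v (ks n) \subset B -> dep (edges B B) (good n v).
Proof.
move=> vB S T; apply: good_local => a b av bv.
by rewrite adj_mix_in //; apply: (subsetP vB).
Qed.

(** Induction on the scale: inside one sub-ball use its giant, between two sub-balls use the edge
    joining their giants. *)
Lemma giant_connect n v S a b : good n v S -> a \in giant n v S -> b \in giant n v S ->
  connect (adj S) a b.
Proof.
elim: n v a b => [|n IHn] v a b gv.
  rewrite !inE ks0 !leqn0 !(hd_eq0 uV) => /andP[/eqP <- _] /andP[/eqP <- _].
  exact: connect0.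
rewrite !inE !innerS => /andP[av /andP[ga ia]] /andP[bv /andP[gb ib]].
have ina u : inner n u S -> u \in giant n u S by move=> iu; rewrite inE (ball_refl uV).
have [ab|ab] := leqP (hd a b) (ks n).
  by apply: (IHn a) => //; [exact: ina | rewrite inE inE ab].
have [||_ /(_ ga gb)/joinedP[a' [b' [aa' bb' adj']]]] := goodP n v S gv a b _ _ ab; rewrite ?inE //.
apply: connect_trans (IHn a a a' ga (ina _ ia) aa') _.
apply: connect_trans (connect1 adj') _.
exact: IHn gb bb' (ina _ ib).
Qed.

(** A canonical point of the ball: the predicate given to [pick] is the same for all centres u of
    one ball, and u itself satisfies it, so [pick] succeeds. *)
Definition rep k u : V := odflt u [pick w | (hd u w <= k)%N].

Lemma rep_ball k u : rep k u \in ball u k.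
Proof.
rewrite /rep inE; case: pickP => [w //|/(_ u)] /=.
by rewrite (hdxx uV).
Qed.

Lemma rep_eq k u v : v \in ball u k -> rep k v = rep k u.
Proof.
move=> vu; rewrite /rep; have e w : (hd v w <= k)%N = (hd u w <= k)%N.
  by have /setP/(_ w) := ballE uV vu; rewrite !inE.
rewrite (eq_pick e); case: pickP => [//|/(_ u)] /=.
by rewrite (hdxx uV).
Qed.

Definition reps v k l : {set V} := [set rep k u | u in ball v l].

Lemma reps_rep v k l r : r \in reps v k l -> rep k r = r.
Proof. by case/imsetP => u _ ->; apply: rep_eq; exact: rep_ball. Qed.

Lemma reps_sep v k l r r' : r \in reps v k l -> r' \in reps v k l -> r != r' -> (k < hd r r')%N.
Proof.
move=> hr hr' nr; rewrite ltnNge; apply: contra nr => rr'.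
by rewrite -(reps_rep hr) -(reps_rep hr') (@rep_eq k r r') // inE.
Qed.

Lemma reps_sub v k l r : (k <= l)%N -> r \in reps v k l -> r \in ball v l.
Proof. by move=> kl /imsetP[u uv ->]; exact: ball_trans uv (rep_ball k u) kl. Qed.

Lemma reps_block v k l r u : (k <= l)%N -> r \in reps v k l ->
  (u \in ball v l) && (rep k u == r) = (u \in ball r k).
Proof.
move=> kl hr; apply/andP/idP => [[uv /eqP <-]|ur].
  by rewrite hd_swap rep_ball.
by rewrite (rep_eq ur) (reps_rep hr) eqxx (ball_trans (reps_sub kl hr) ur).
Qed.

Lemma sum_reps v k l (F : V -> nat) : (k <= l)%N ->
  (\sum_(u in ball v l) F u = \sum_(r in reps v k l) \sum_(u in ball r k) F u)%N.
Proof.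
move=> kl; rewrite (partition_big (rep k) (mem (reps v k l))) /=; last first.
  by move=> u uv; apply: imset_f.
by apply: eq_bigr => r hr; apply: eq_bigl => u; rewrite reps_block.
Qed.

Lemma card_reps v k l : (k <= l)%N -> (l <= K)%N -> #|reps v k l| = (N ^ (l - k))%N.
Proof.
move=> kl lK; have := @sum_reps v k l (fun=> 1%N) kl.
rewrite sum1_card (card_hd uV) // (eq_bigr (fun=> N ^ k)%N) => [|r _]; last first.
  by rewrite sum1_card (card_hd uV) // (leq_trans kl).
rewrite sum_nat_const -{1}(subnK kl) expnD => /eqP.
by rewrite eqn_pmul2r ?expn_gt0 ?(ltnW N1) // => /eqP.
Qed.

Lemma pr_not_joined_le A B (t : R) : [disjoint A & B] ->
  (forall u v, u \in A -> v \in B -> t <= c (hd u v) / N%:R ^+ (2 * hd u v)) ->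
  pr pe (predC (joined A B)) <= expR (- (t * (#|A|%:R * #|B|%:R))).
Proof.
move=> AB ht; rewrite (pr_not_joined peE AB).
have -> : expR (- (t * (#|A|%:R * #|B|%:R))) = \prod_(u in A) \prod_(v in B) expR (- t).
  by rewrite !prodr_const -!expRM_natl; congr expR; ring.
have p1 u v : 0 <= 1 - @edgep R N c (hd u v) by rewrite subr_ge0 ge_min lexx orbT.
apply: ler_prod => u uA; rewrite prodr_ge0 //=; apply: ler_prod => v vB; rewrite p1 /=.
(* For t > 1 the cap in [edgep] is reached and every factor vanishes. *)
have [t1|t1] := leP t 1; last first.
  have -> : @edgep R N c (hd u v) = 1 by apply/min_idPr; exact: le_trans (ltW t1) (ht _ _ uA vB).
  by rewrite subrr expR_ge0.
apply: le_trans (expR_ge1Dx _); rewrite lerD2l lerN2 le_min t1 andbT; exact: ht.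
Qed.

(** * Density of giants and probability of bad balls *)

Section Estimates.
(** At scale n, x bounds the density of giants from below, eps the probability of a bad ball from
    above, and lo the rates c_j beyond radius [ks n] from below; [M n] is the number of sub-balls of
    scale n in a ball of scale n+1. *)
Context (x eps lo : nat -> R).
Let M n : R := N%:R ^+ (ks n.+1 - ks n).
Hypothesis x_le1 : forall n, x n <= 1.
Hypothesis x_ge0 : forall n, 0 <= x n.
Hypothesis xS : forall n, x n.+1 <= x n - (M n)^-1.
Hypothesis lo_c : forall n j, (ks n < j)%N -> lo n <= c j.
Hypothesis lo0 : forall n, 0 <= lo n.
Hypothesis eps0 : forall n, 0 <= eps n.
Hypothesis epsS : forall n,
  M n ^+ 2 * (eps n ^+ 2 + expR (- (lo n * x n ^+ 2 / M n ^+ 2))) <= eps n.+1.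

(** At most one of the M n sub-balls is bad, so at least (M n - 1) x n N^(ks n) points remain; this
    suffices because x n <= 1 and x drops by at least 1/M n. *)
Lemma card_giant n v S : (ks n <= K)%N -> good n v S ->
  x n * N%:R ^+ ks n <= #|giant n v S|%:R.
Proof.
have Np := @N_gt0 R N N1.
elim: n v => [|n IHn] v nK gv.
  rewrite ks0 expr0 mulr1 (le_trans (x_le1 0)) // ler1n; apply/card_gt0P.
  by exists v; rewrite inE (ball_refl uV).
have kl := ltnW (ksS n); have kK := leq_trans kl nK.
have -> : #|giant n.+1 v S| =
    (\sum_(r in reps v (ks n) (ks n.+1)) (if good n r S then #|giant n r S| else 0))%N.
  rewrite -sum1_card (eq_bigl (fun u => (u \in ball v (ks n.+1)) && inner n.+1 u S)); last first.
    by move=> u; rewrite /giant inE.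
  rewrite big_mkcondr (sum_reps _ _ kl); apply: eq_bigr => r hr.
  rewrite -big_mkcondr.
  case: ifP => gr.
    rewrite -sum1_card; apply: eq_bigl => u; rewrite [in RHS]inE innerS.
    by case: (boolP (u \in ball r _)) => //= ur; rewrite (good_ball _ ur) gr.
  rewrite big_pred0 // => u; case: (boolP (u \in ball r _)) => //= ur.
  by rewrite innerS (good_ball _ ur) gr.
have Mp : 0 < M n by rewrite exprn_gt0.
have NE : N%:R ^+ ks n.+1 = M n * N%:R ^+ ks n by rewrite -exprD subnK.
have cR : #|reps v (ks n) (ks n.+1)|%:R = M n :> R by rewrite card_reps // natrX.
apply: (@le_trans _ _ ((M n - 1) * (x n * N%:R ^+ ks n))).
  rewrite NE; apply: (@le_trans _ _ ((x n - (M n)^-1) * (M n * N%:R ^+ ks n))).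
    by rewrite ler_wpM2r // mulr_ge0 ?exprn_ge0 ?ler0n.
  have -> : (x n - (M n)^-1) * (M n * N%:R ^+ ks n) =
     (M n - 1) * (x n * N%:R ^+ ks n) - (1 - x n) * N%:R ^+ ks n by field; rewrite gt_eqF.
  by rewrite gerBl mulr_ge0 ?subr_ge0 ?exprn_ge0 ?ler0n.
set Rs := reps _ _ _ in cR *.
have bad1 : (#|[set r in Rs | ~~ good n r S]| <= 1)%N.
  apply/card_le1_eqP => r r'; rewrite !inE => /andP[hr br] /andP[hr' br'].
  apply/eqP; apply: contraT => rr'.
  have [|h1 _] := goodP n v S gv r' r (reps_sub kl hr') (reps_sub kl hr).
    by apply: (reps_sep hr' hr).
  by move: h1; rewrite (negbTE br) (negbTE br').
have cG : #|Rs| = (#|[set r in Rs | good n r S]| + #|[set r in Rs | ~~ good n r S]|)%N.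
  rewrite -(cardsID [set r | good n r S] Rs); congr (_ + _)%N; apply: eq_card => r.
    by rewrite !inE.
  by rewrite !inE andbC.
rewrite natr_sum.
apply: (@le_trans _ _ (\sum_(r in [set r in Rs | good n r S]) x n * N%:R ^+ ks n)).
  rewrite sumr_const -[leRHS]mulr_natl ler_wpM2r ?mulr_ge0 ?exprn_ge0 ?ler0n //.
  by rewrite -cR lerBlDr cG natrD lerD2l lern1.
rewrite big_mkcond [leRHS]big_mkcond; apply: ler_sum => r _; rewrite inE.
case: (r \in Rs) => //=; case: ifP => // gr; exact: IHn.
Qed.

(** Union bound over the at most M^2 pairs of sub-balls: either both are bad, which costs eps^2 by
    independence, or both are good and their giants are not joined. Each giant has at least x n
    N^(ks n) points and each pair of points is joined with probability at least lo n / N^(2 ks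
    (n+1)), capped at 1, whence the exponent lo x^2 / M^2. *)
Lemma pr_bad n v : (ks n <= K)%N -> pr pe (predC (good n v)) <= eps n.
Proof.
have Np := @N_gt0 R N N1.
elim: n v => [|n IHn] v nK; first by rewrite /pr big_pred0.
have kl := ltnW (ksS n); have kK := leq_trans kl nK.
set Rs := reps v (ks n) (ks n.+1).
have cR : #|Rs|%:R = M n :> R by rewrite card_reps // natrX.
pose Q (q : V * V) := [&& q.1 \in Rs, q.2 \in Rs & (ks n < hd q.1 q.2)%N].
pose F1 (q : V * V) := predI (predC (good n q.1)) (predC (good n q.2)).
pose F2 (q : V * V) := predI (predI (good n q.1) (good n q.2))
   (fun S => ~~ joined (giant n q.1 S) (giant n q.2 S) S).
apply: (@le_trans _ _ (pr pe (fun S => [exists q, Q q && predU (F1 q) (F2 q) S]))).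
  apply: (le_pr pe01) => S; apply: contraR => /existsPn nq.
  apply/goodP => u w uv wv uw.
  have ru := rep_ball (ks n) u; have rw := rep_ball (ks n) w.
  have rr : (ks n < hd (rep (ks n) u) (rep (ks n) w))%N.
    rewrite ltnNge; apply: contraL uw => h; rewrite -leqNgt.
    rewrite (leq_trans (hd_ultra uV (rep (ks n) u) u w)) // geq_max.
    move: ru rw; rewrite !inE => -> rw /=.
    by rewrite (leq_trans (hd_ultra uV (rep (ks n) w) _ w)) // geq_max h (hd_sym uV).
  have := nq (rep (ks n) u, rep (ks n) w).
  have ruR : rep (ks n) u \in Rs by apply: imset_f.
  have rwR : rep (ks n) w \in Rs by apply: imset_f.
  rewrite /Q /F1 /F2 /= rr ruR rwR /= !(good_ball _ ru) !(good_ball _ rw).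
  rewrite (giant_ball _ ru) (giant_ball _ rw) -negb_or negb_or negbK.
  move=> /andP[-> h2]; split=> // gu gw; move: h2.
  by rewrite gu gw negbK.
apply: le_trans (pr_exists pe01 Q _) _.
pose ex := expR (- (lo n * x n ^+ 2 / M n ^+ 2)).
apply: (@le_trans _ _ (\sum_(q | Q q) (eps n ^+ 2 + ex))); last first.
  apply: le_trans (epsS n); rewrite sumr_const -[leLHS]mulr_natl ler_wpM2r //.
    by rewrite addr_ge0 ?exprn_ge0 ?expR_ge0.
  rewrite -cR -natrX ler_nat -[leqRHS]mulnn -cardsX; apply: subset_leq_card.
  by apply/subsetP => q /and3P[q1 q2 _]; rewrite inE q1.
apply: ler_sum => -[r r'] /and3P[/= hr hr' rr'].
have dB : [disjoint ball r (ks n) & ball r' (ks n)].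
  by apply: (ball_disj uV); rewrite inE -ltnNge.
apply: le_trans (prU pe01 _ _) (lerD _ _).
  have dr u : dep (edges (ball u (ks n)) (ball u (ks n))) (predC (good n u)).
    by move=> S T; rewrite /= dep_good.
  rewrite (pr_indep _ (dr r) (dr r')) ?edges_disj //.
  by rewrite expr2; apply: ler_pM; rewrite ?pr_ge0 // IHn.
rewrite -[leRHS]mulr1.
pose B := ball r (ks n); pose B' := ball r' (ks n).
(* Given the edges inside the two sub-balls, their giants are fixed while the edges between them
   remain free. *)
pose J := edges B B :|: edges B' B'.
have dJ : dep J (predI (good n r) (good n r')).
  by apply: depI; [apply: (@dep_sub _ (edges B B)) | apply: (@dep_sub _ (edges B' B'))];
    rewrite ?subsetUl ?subsetUr //; apply: dep_good.
apply: le_trans (pr_cond pe01 (expR_ge0 (- (lo n * x n ^+ 2 / M n ^+ 2))) dJ _) _; last first.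
  by rewrite ler_wpM2l ?expR_ge0 ?pr_le1.
move=> A /= /andP[gr gr'].
have loc T a b : (a \in B) && (b \in B) || (a \in B') && (b \in B') ->
    adj (mix J A T) a b = adj A a b.
  by move=> ab; rewrite adj_mix inE !edgesE ab.
have gE T : giant n r (mix J A T) = giant n r A.
  by apply: giant_local => a b aB bB; apply: loc; rewrite aB bB.
have gE' T : giant n r' (mix J A T) = giant n r' A.
  by apply: giant_local => a b aB bB; apply: loc; rewrite aB bB orbT.
have sB : giant n r A \subset B by apply/subsetP => a; rewrite inE => /andP[].
have sB' : giant n r' A \subset B' by apply/subsetP => a; rewrite inE => /andP[].
have dG : [disjoint giant n r A & giant n r' A].
  by rewrite (disjointWl sB) // (disjointWr sB').
apply: (@le_trans _ _ (pr pe (predC (joined (giant n r A) (giant n r' A))))).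
  apply: (le_pr pe01) => T; rewrite /= gE gE'; congr (~~ _); apply: eq_joined => a b aG bG.
  rewrite adj_mix inE !edgesE (disjointFl dB (subsetP sB' _ bG)).
  by rewrite (disjointFr dB (subsetP sB _ aG)) andbF.
apply: le_trans (@pr_not_joined_le _ _ (lo n / N%:R ^+ (2 * ks n.+1)) dG _) _.
  move=> a b /(subsetP sB) aB /(subsetP sB') bB.
  have k_ab : (ks n < hd a b)%N.
    rewrite ltnNge; apply/negP => ab; have := disjointFl dB bB.
    by rewrite (ballE uV aB) inE ab.
  have ab : (hd a b <= ks n.+1)%N.
    have al := ball_trans (reps_sub kl hr) aB kl; have bl := ball_trans (reps_sub kl hr') bB kl.
    by move: bl; rewrite (ballE uV al) inE.
  apply: ler_pM; rewrite ?invr_ge0 ?exprn_ge0 ?ler0n ?lo_c //.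
  by rewrite lef_pV2 ?posrE ?exprn_gt0 // ler_weXn2l ?ler1n ?(ltnW N1) // leq_mul2l.
rewrite ler_expR lerN2.
apply: (@le_trans _ _ (lo n / N%:R ^+ (2 * ks n.+1) *
   ((x n * N%:R ^+ ks n) * (x n * N%:R ^+ ks n)))).
  rewrite le_eqVlt; apply/orP; left; apply/eqP.
  have E : N%:R ^+ ks n.+1 = M n * N%:R ^+ ks n by rewrite -exprD subnK.
  rewrite mul2n -addnn exprD E.
  by field; rewrite !expf_neq0 ?gt_eqF.
rewrite ler_wpM2l ?divr_ge0 ?exprn_ge0 ?ler0n //.
by apply: ler_pM; rewrite ?mulr_ge0 ?exprn_ge0 ?ler0n ?card_giant.
Qed.


Lemma inner_good n u S : (forall i, (i < n)%N -> good i u S) -> inner n u S.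
Proof.
elim: n => [//|n IHn] h; rewrite innerS h // IHn // => i i_n.
by apply: h; rewrite ltnS ltnW.
Qed.

(** If all balls around o up to scale n+1 are good, o lies in the giant of scale n+1, which by
    [card_giant] has more points than the ball of scale n and so reaches beyond it. *)
Lemma escapes_ge o n : (ks n.+1 <= K)%N -> 1 < x n.+1 * M n ->
  1 - \sum_(i < n.+2) eps i <= pr pe (@escapes V hd o o (ks n)).
Proof.
move=> nK xM; rewrite -[leRHS](subKr 1) -(prC pe) lerD2l lerN2.
apply: (@le_trans _ _ (pr pe (fun S => has (fun i => ~~ good i o S) (iota 0 n.+2)))).
  apply: (le_pr pe01) => S; apply: contraR => /hasPn ng.
  have g i : (i < n.+2)%N -> good i o S.
    by move=> i_n; have := ng i; rewrite mem_iota add0n i_n negbK; apply.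
  have gn := g n.+1 (ltnSn _).
  have big : (#|ball o (ks n)| < #|giant n.+1 o S|)%N.
    rewrite (card_hd uV) ?(leq_trans (ltnW (ksS n))) // -(ltr_nat R) natrX.
    apply: lt_le_trans (card_giant nK gn).
    have -> : x n.+1 * N%:R ^+ ks n.+1 = x n.+1 * M n * N%:R ^+ ks n.
      by rewrite -mulrA -exprD subnK // ltnW.
    by rewrite -[ltLHS]mul1r ltr_pM2r // exprn_gt0 // (@N_gt0 R N N1).
  have [y yg yo] : exists2 y, y \in giant n.+1 o S & y \notin ball o (ks n).
    apply/subsetPn; apply: contraL big => /subset_leq_card.
    by rewrite -leqNgt.
  apply/existsP; exists y; apply/andP; split.
    by move: yo; rewrite inE -ltnNge.
  apply: giant_connect gn _ yg; rewrite inE (ball_refl uV) inner_good // => i i_n.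
  by apply: g; rewrite ltnS ltnW.
apply: le_trans (prU_seq pe01 _ _) _; apply: ler_sum => i _; apply: pr_bad.
by apply: leq_trans nK; apply: ks_mono; rewrite -ltnS.
Qed.

(** * Clusters that leave a ball without meeting a giant *)

Definition cluster_in B S u : {set V} :=
  [set v | connect (fun a b => [&& a \in B, b \in B & adj S a b]) u v].

Lemma cluster_in_sub B S u : u \in B -> cluster_in B S u \subset B.
Proof.
move=> uB; apply/subsetP => v; rewrite inE => /connectP[p pp ->].
by elim: p u uB pp => [//|w p IHp] u uB /= /andP[/and3P[_ wB _]]; exact: IHp.
Qed.

Lemma cluster_in_connect B S u v : v \in cluster_in B S u -> connect (adj S) u v.
Proof.
rewrite inE; apply: connect_sub => a b /and3P[_ _ ab]; exact: connect1.
Qed.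

Lemma cluster_in_local B S T u : (forall a b, a \in B -> b \in B -> adj S a b = adj T a b) ->
  cluster_in B S u = cluster_in B T u.
Proof.
move=> h; apply/setP => v; rewrite !inE; apply: eq_connect => a b.
by case: (boolP (a \in B)) => //= aB; case: (boolP (b \in B)) => //= bB; exact: h.
Qed.

Lemma cluster_in_step B S u v w : u \in B -> v \in cluster_in B S u -> w \in B -> adj S v w -> w \in cluster_in B S u.
Proof.
move=> uB vc wB vw; have vB := subsetP (cluster_in_sub S uB) v vc.
move: vc; rewrite !inE => /connect_trans; apply; apply: connect1.
by rewrite vB wB.
Qed.

(** Centre of a ball of radius k disjoint from the one around o but inside the same ball of radius
    k+1; such a point exists when k < K. *)
Definition sibling k o : V := odflt o [pick z | hd o z == k.+1].

Lemma hd_sibling k o : (k < K)%N -> hd o (sibling k o) = k.+1.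
Proof.
move=> kK; rewrite /sibling; case: pickP => [z /eqP //|z0].
have := card_sphere uV o kK; rewrite eq_card0 => [|z]; last by rewrite inE z0.
by move/eqP; rewrite eq_sym subn_eq0 leqNgt ltn_exp2l // ltnSn.
Qed.

(* The cluster of u inside the ball of scale n reaches the shell up to scale n', yet is not
   attached to the giant of the sibling ball. *)
Definition trapped o u n n' S :=
  joined (cluster_in (ball o (ks n)) S u) (ball o (ks n') :\: ball o (ks n)) S &&
  ~~ (good n (sibling (ks n) o) S &&
      joined (cluster_in (ball o (ks n)) S u) (giant n (sibling (ks n) o) S) S).

Lemma sibling_ball o n n' : (n < n')%N -> (ks n' <= K)%N ->
  ball (sibling (ks n) o) (ks n) \subset ball o (ks n').
Proof.
move=> nn' nK; have kk : (ks n < ks n')%N by apply: leq_trans (ksS n) (ks_mono nn').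
apply/subsetP => v vz; apply: ball_trans vz (ltnW kk).
by rewrite inE hd_sibling // (leq_trans kk).
Qed.

Lemma sibling_disj o n : (ks n < K)%N -> [disjoint ball o (ks n) & ball (sibling (ks n) o) (ks n)].
Proof. by move=> nK; apply: (ball_disj uV); rewrite inE hd_sibling // ltnn. Qed.

Lemma dep_trapped o u n n' : (n < n')%N -> (ks n' <= K)%N -> u \in ball o (ks n) ->
  dep (edges (ball o (ks n')) (ball o (ks n'))) (trapped o u n n').
Proof.
move=> nn' nK uB S T; have kk : (ks n <= ks n')%N by apply: ks_mono; exact: ltnW.
set B' := ball o (ks n'); have sB : ball o (ks n) \subset B' by apply: ball_sub.
have zB := sibling_ball o nn' nK.
rewrite /trapped (@cluster_in_local _ _ S) => [|a b aB bB]; last first.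
  by rewrite adj_mix_in //; [apply: (subsetP sB) | apply: (subsetP sB)].
have cB : cluster_in (ball o (ks n)) S u \subset B' by apply: subset_trans (cluster_in_sub S uB) sB.
rewrite dep_joined //; last by apply/subsetP => v; rewrite inE => /andP[].
have -> : giant n (sibling (ks n) o) (mix (edges B' B') S T) = giant n (sibling (ks n) o) S.
  by apply: giant_local => a b aB bB; rewrite adj_mix_in //; [apply: (subsetP zB) | apply: (subsetP zB)].
rewrite dep_good // dep_joined //.
by apply/subsetP => v; rewrite inE => /andP[vz _]; apply: (subsetP zB).
Qed.

(** Midway between 1 and E = exp(-1/(12 N^2)), so that both 1/2 and (1-E)/2 + E are at most this
    rate. *)
Definition trap_rate : R := (1 + expR (- (12 * N%:R ^+ 2)^-1)) / 2.

(** The edges inside the ball are frozen to those of S0, so the cluster A of u is fixed; put k =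
    [ks n] and f = |A| c_k / N^k. If f <= 1/6, A has an edge into the shell with probability at most
    3f <= 1/2. Otherwise the sibling ball is bad with probability at most eps n, and a good one is
    missed with probability at most exp(-f/(2 N^2)) <= exp(-1/(12 N^2)), since its giant fills at
    least half of a ball at distance k+1. *)
Lemma pr_trapped o u n n' S0 : (n < n')%N -> (ks n' <= K)%N -> u \in ball o (ks n) ->
  (0 < ks n)%N -> (forall j, (ks n <= j)%N -> c j.+1 <= 3 / 2 * c j) ->
  c (ks n) <= c (ks n).+1 -> 1 / 2 <= x n ->
  eps n <= (1 - expR (- (12 * N%:R ^+ 2)^-1)) / 2 ->
  pr pe (fun T => trapped o u n n' (mix (edges (ball o (ks n)) (ball o (ks n))) S0 T)) <= trap_rate.
Proof.
move=> nn' nK uB k0 hr hm hx he; have Np := @N_gt0 R N N1.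
have kK : (ks n < K)%N by apply: leq_trans nK; apply: leq_trans (ksS n) (ks_mono nn').
set z := sibling (ks n) o; set B := ball o (ks n); set Z := ball z (ks n).
set D := ball o (ks n') :\: B; set A := cluster_in B S0 u.
have dBZ : [disjoint B & Z] by apply: sibling_disj.
have AB : A \subset B by apply: cluster_in_sub.
have mixE T : trapped o u n n' (mix (edges B B) S0 T) =
    joined A D T && ~~ (good n z T && joined A (giant n z T) T).
  rewrite /trapped -/B -/D -/z (@cluster_in_local _ _ S0) => [|a b aB bB]; last by rewrite adj_mix_in.
  have gz a b : a \in Z -> b \in Z -> adj (mix (edges B B) S0 T) a b = adj T a b.
    by move=> _ bZ; rewrite adj_mix_out // (disjointFl dBZ bZ).
  rewrite (good_local gz) (giant_local gz) -/A !joined_mix //.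
    by rewrite disjoint_sym (disjointWr _ dBZ) //; apply/subsetP => v; rewrite inE => /andP[].
  by rewrite disjoint_sym -setI_eq0 /D setDE setICA setICr setI0.
rewrite (eq_pr _ mixE) => {mixE}.
pose f := #|A|%:R * c (ks n) / N%:R ^+ ks n.
have f0 : 0 <= f by rewrite !mulr_ge0 ?invr_ge0 ?exprn_ge0 ?ler0n ?c0.
set E := expR _ in he; rewrite /trap_rate -/E.
have Ep : 0 < E by apply: expR_gt0.
have [f6|f6] := leP f 6^-1.
  apply: (@le_trans _ _ (3 * f)); last by lra.
  apply: (@le_trans _ _ (pr pe (joined A D))).
    by apply: (le_pr pe01) => T /andP[].
  apply: le_trans (pr_joined_out uV N1 c0 pe01 peE (k := ks n) _) _.
    move=> a b /(subsetP AB) aB; rewrite inE => /andP[bB _].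
    by move: bB; rewrite /B (ballE uV aB) inE -ltnNge.
  have := tail_sum N1 c0 K.+1 k0 (leqnn _) hr.
  rewrite subnn expr0 mulr1 => ht.
  have -> : 3 * f = #|A|%:R * (3 * c (ks n) / N%:R ^+ ks n) by rewrite /f; ring.
  by rewrite ler_wpM2l ?ler0n // ler_pdivlMr ?exprn_gt0 // mulrC.
apply: (@le_trans _ _ (eps n + E)); last by lra.
pose G T := ~~ joined A (giant n z T) T.
apply: (@le_trans _ _ (pr pe (predU (predC (good n z)) (predI (good n z) G)))).
  apply: (le_pr pe01) => T /andP[_]; rewrite negb_and /= /G.
  by case: (good n z T).
apply: le_trans (prU pe01 _ _) (lerD (pr_bad z (ltnW kK)) _).
rewrite -[leRHS]mulr1.
have dz : dep (edges Z Z) (good n z) by apply: dep_good.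
apply: le_trans (pr_cond pe01 (ltW Ep) dz _) _; last by rewrite ler_wpM2l ?(ltW Ep) ?pr_le1.
move=> A1 gA1; set H := giant n z A1.
have HZ : H \subset Z by apply/subsetP => v; rewrite inE => /andP[].
have dAH : [disjoint A & H] by rewrite (disjointWl AB) // (disjointWr HZ).
apply: (@le_trans _ _ (pr pe (predC (joined A H)))).
  apply: (le_pr pe01) => T; rewrite /G /=.
  rewrite (@giant_local n _ A1) => [|a b aZ bZ]; last by rewrite adj_mix_in.
  rewrite -/H (@eq_joined _ A H _ T) // => a b /(subsetP AB) aB _.
  by rewrite adj_mix edgesE (disjointFr dBZ aB).
apply: le_trans (@pr_not_joined_le _ _ (c (ks n) / N%:R ^+ (2 * (ks n).+1)) dAH _) _.
  move=> a b /(subsetP AB) aB /(subsetP HZ) bZ.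
  have -> : hd a b = (ks n).+1.
    apply/eqP; rewrite eqn_leq; apply/andP; split.
      have az : a \in ball z (ks n).+1.
        have ao := subsetP (ball_sub o (leqnSn (ks n))) a aB.
        have zo : z \in ball o (ks n).+1 by rewrite inE hd_sibling.
        by rewrite -(ballE uV zo).
      have bz := subsetP (ball_sub z (leqnSn (ks n))) b bZ.
      by move: bz; rewrite (ballE uV az) inE.
    by have := disjointFl dBZ bZ; rewrite /B (ballE uV aB) inE ltnNge => ->.
  by rewrite ler_wpM2r // invr_ge0 exprn_ge0 ?ler0n.
rewrite ler_expR lerN2.
have cH : 1 / 2 * N%:R ^+ ks n <= #|H|%:R :> R.
  by apply: le_trans (card_giant (ltnW kK) gA1); rewrite ler_wpM2r ?exprn_ge0 ?ler0n.
apply: (@le_trans _ _ (f / (2 * N%:R ^+ 2))).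
  have -> : (12 * N%:R ^+ 2)^-1 = 6^-1 / (2 * N%:R ^+ 2) :> R by field; rewrite gt_eqF.
  by rewrite ler_wpM2r ?ltW // invr_gt0 mulr_gt0 ?exprn_gt0.
apply: (@le_trans _ _ (c (ks n) / N%:R ^+ (2 * (ks n).+1) * (#|A|%:R * (1 / 2 * N%:R ^+ ks n)))).
  rewrite le_eqVlt; apply/orP; left; apply/eqP.
  rewrite /f mul2n -addnn exprD !exprS.
  by field; rewrite ?expf_neq0 ?gt_eqF.
by rewrite ler_wpM2l ?ler_wpM2l ?ler0n // mulr_ge0 ?c0 // invr_ge0 exprn_ge0 ?ler0n.
Qed.

(** Four kinds of exceptional events give the bound: an edge jumps from a level past the next; a
    ball around o is bad at some scale from l 0 to l L; u is trapped at every level; v is. Otherwise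
    both clusters meet the giant of scale l L around o, which is connected. *)
Lemma pr_two_clusters o u v (l : nat -> nat) L (e : R) :
  (forall i, (i < L)%N -> l i < l i.+1)%N -> (0 < L)%N -> (ks (l L) <= K)%N -> (0 < l 0)%N ->
  u \in ball o (ks (l 0)) -> v \in ball o (ks (l 0)) ->
  (forall j, (ks (l 0) <= j)%N -> c j.+1 <= 3 / 2 * c j) ->
  (forall j, (0 < j)%N -> c j <= c j.+1) ->
  (forall n, 1 / 2 <= x n) ->
  (forall n, (l 0 <= n)%N -> eps n <= (1 - expR (- (12 * N%:R ^+ 2)^-1)) / 2) ->
  (forall i, (i < L)%N ->
     N%:R ^+ ks (l i) * \sum_(j < K.+1 | (ks (l i.+1) < j)%N) c j / N%:R ^+ j <= e) ->
  pr pe (fun S => [&& @escapes V hd o u (ks (l L)) S, @escapes V hd o v (ks (l L)) S &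
                      ~~ connect (adj S) u v]) <=
  L%:R * e + (\sum_(l 0 <= n < (l L).+1) eps n + (trap_rate ^+ L + trap_rate ^+ L)).
Proof.
move=> lS L0 lK l0 uB vB hr hm hx he hsk.
have lmono i j : (i <= j)%N -> (j <= L)%N -> (l i <= l j)%N.
  elim: j => [|j IHj]; first by case: i.
  rewrite leq_eqVlt => /orP[/eqP -> //|ij jL].
  exact: leq_trans (IHj ij (ltnW jL)) (ltnW (lS _ jL)).
have inB i w : (i <= L)%N -> w \in ball o (ks (l 0)) -> w \in ball o (ks (l i)).
  by move=> iL; apply: subsetP; apply: ball_sub; apply: ks_mono; exact: lmono.
have kK i : (i <= L)%N -> (ks (l i) <= K)%N.
  by move=> iL; apply: leq_trans lK; apply: ks_mono; exact: lmono.
pose B i := ball o (ks (l i)).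
pose skip i := joined (B i) (~: B i.+1).
pose W w i := trapped o w (l i) (l i.+1).
(* An escaping cluster that is not trapped at level i leaves the ball of scale l i into the next
   shell, hence meets the giant of a good sibling ball. *)
have main w S : w \in ball o (ks (l 0)) -> @escapes V hd o w (ks (l L)) S ->
    (forall i, (i < L)%N -> ~~ skip i S) -> (forall n, (l 0 <= n <= l L)%N -> good n o S) ->
    all (fun i => W w i S) (iota 0 L) \/
    exists2 g, connect (adj S) w g & g \in giant (l L) o S.
  move=> wB /existsP[y /andP[yK wy]] ns gd.
  case: (boolP (all _ _)) => [|/allPn[i]]; first by left.
  rewrite mem_iota add0n => /andP[_ iL] nW; right.
  have wBi := inB i w (ltnW iL) wB.
  have wc : w \in cluster_in (B i) S w by rewrite inE connect0.
  have yc : y \notin cluster_in (B i) S w.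
    apply/negP => /(subsetP (cluster_in_sub S wBi)); rewrite inE leqNgt.
    by rewrite (leq_ltn_trans _ yK) // ks_mono // lmono // ltnW.
  have [a [b [aA _ bA ab]]] := connect_joined wc yc wy.
  have bB : b \notin B i by apply: contra bA => bB; exact: cluster_in_step aA bB ab.
  have bB' : b \in B i.+1.
    have := ns i iL; apply: contraR => bB'; apply/joinedP; exists a, b.
    by rewrite in_setC bB' (subsetP (cluster_in_sub S wBi)).
  have : joined (cluster_in (B i) S w) (B i.+1 :\: B i) S.
    by apply/joinedP; exists a, b; rewrite in_setD bB bB'.
  move: nW; rewrite /W /trapped => /nandP[/negP nj /nj //|].
  rewrite negbK => /andP[gz /joinedP[a' [g [a'A gG a'g]]]] _.
  exists g; first exact: connect_trans (cluster_in_connect a'A) (connect1 a'g).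
  have lL : (l i < l L)%N by apply: leq_trans (lS i iL) (lmono _ _ iL (leqnn _)).
  move: gG; rewrite inE => /andP[gb ig].
  have gB : g \in ball o (ks (l i).+1).
    exact: subsetP (sibling_ball o (ltnSn _) (leq_trans (ks_mono lL) lK)) g gb.
  have gm m : (l i < m <= l L)%N -> g \in ball o (ks m).
    by move=> /andP[im _]; apply: subsetP gB; apply: ball_sub; exact: ks_mono.
  rewrite inE gm ?lL ?leqnn //=.
  (* Climbing the scales: the sibling ball is good, and every larger ball around g is a ball around
     o, good by [gd]; so g stays inner up to scale l L. *)
  elim: {-2}(l L) (leqnn (l L)) lL => [//|m IHm] mL.
  rewrite ltnS leq_eqVlt => /orP[/eqP im|im].
    by rewrite innerS -im ig (good_ball _ gb) gz.
  rewrite innerS IHm ?(ltnW mL) // andbT (@good_ball _ _ _ o) ?gm ?im ?(ltnW mL) //.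
  by apply: gd; rewrite (ltnW mL) (leq_trans (lmono 0 i _ _)) // ltnW.
have [m Em] : {m | m = (l L - l 0).+1} by exists (l L - l 0).+1.
apply: (@le_trans _ _ (pr pe (predU (fun S => has (skip^~ S) (iota 0 L))
   (predU (fun S => has (fun n => ~~ good (l 0 + n) o S) (iota 0 m))
   (predU (fun S => all (fun i => W u i S) (iota 0 L)) (fun S => all (fun i => W v i S) (iota 0 L))))))).
  apply: (le_pr pe01) => S /and3P[eu ev nuv] /=.
  case: (boolP (has _ _)) => //= /hasPn ns.
  case: (boolP (has _ _)) => //= /hasPn ng.
  have ns' i : (i < L)%N -> ~~ skip i S.
    by move=> iL; have := ns i; rewrite mem_iota add0n iL; apply.
  have gd n : (l 0 <= n <= l L)%N -> good n o S.
    move=> /andP[n0 nL]; have := ng (n - l 0)%N; rewrite mem_iota add0n Em ltnS leq_sub2r //.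
    by move=> /(_ isT); rewrite negbK subnKC.
  have [-> //|[g ug gG]] := main u S uB eu ns' gd.
  have [-> |[h vh hG]] := main v S vB ev ns' gd; first by rewrite orbT.
  case/negP: nuv; apply: connect_trans ug _.
  apply: (@connect_trans _ _ h).
    by apply: giant_connect gG hG; apply: gd; rewrite lmono ?leqnn.
  by rewrite (sym_connect_sym (@adj_sym V S)).
apply: le_trans (prU pe01 _ _) (lerD _ _).
  apply: le_trans (prU_seq pe01 _ _) _; rewrite -[L in L%:R]card_ord mulr_natl -sumr_const.
  apply: ler_sum => i _; apply: le_trans (hsk i (ltn_ord i)).
  have -> : N%:R ^+ ks (l i) = #|B i|%:R :> R.
    by rewrite (card_hd uV) ?natrX // kK // ltnW.
  apply: (pr_joined_out uV N1 c0 pe01 peE) => a b aB; rewrite in_setC => bB.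
  rewrite ltnNge; apply: contra bB => ab; rewrite /B inE.
  rewrite (leq_trans (hd_ultra uV a o b)) // geq_max ab andbT.
  by move: aB; rewrite inE => /leq_trans; apply; rewrite ks_mono // ltnW // lS.
apply: le_trans (prU pe01 _ _) (lerD _ _).
  apply: le_trans (prU_seq pe01 _ _) _.
  rewrite -{2}[l 0]add0n big_addn subSn ?lmono // -Em big_mkord.
  apply: ler_sum => i _; rewrite addnC; apply: pr_bad; apply: leq_trans lK; apply: ks_mono.
  by move: (ltn_ord i); rewrite {2}Em ltnS leq_subRL ?lmono // addnC.
have q0 : 0 <= trap_rate by rewrite divr_ge0 ?addr_ge0 ?expR_ge0.
have chain w : w \in ball o (ks (l 0)) -> pr pe (fun S => all (fun i => W w i S) (iota 0 L)) <= trap_rate ^+ L.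
  move=> wB; apply: (@pr_chain _ _ _ pe01 (fun i => edges (B i) (B i)) (W w)) => // i.
  - move=> iL; apply: edgesS; apply: ball_sub; apply: ks_mono; apply: ltnW; exact: lS.
  - by move=> iL; apply: dep_trapped; rewrite ?lS ?kK // inB // ltnW.
  - move=> S0 iL; have i0 : (l 0 <= l i)%N by apply: lmono => //; exact: ltnW.
    have ki : (0 < ks (l i))%N.
      apply: leq_trans (ks_mono (leq_trans l0 i0)); exact: leq_ltn_trans (leq0n _) (ksS 0).
    apply: (pr_trapped _ (lS i iL) (kK _ iL) (inB i w (ltnW iL) wB) ki _ (hm _ ki) (hx _) (he _ i0)).
    by move=> j ij; apply: hr; apply: leq_trans ij; exact: ks_mono.
by apply: le_trans (prU pe01 _ _) (lerD (chain u uB) (chain v vB)).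
Qed.

End Estimates.
End Giants.

(** * Scales *)

Section Scales.
Context {R : realType} {N : nat}.
Hypothesis N1 : (1 < N)%N.

(** Numbers of sub-balls are powers of N, so a prescribed size is met up to a factor N. The [sig]
    type lets the exponents be extracted as a function. *)
Lemma pow_between (z : R) : 1 <= z -> {s : nat | z <= N%:R ^+ s <= N%:R * z}.
Proof.
move=> z1; have Np := @N_gt0 R N N1.
have ex : exists s, z <= N%:R ^+ s.
  have [m /= /andP[zm _]] := nat_upper [:: z]; exists m; apply: le_trans zm _.
  by rewrite -natrX ler_nat ltnW // ltn_expl.
case: (ex_minnP ex) => -[|s] zs hs.
  exists 0%N; rewrite zs /= expr0; apply: (@le_trans _ _ (N%:R * 1)).
    by rewrite mulr1 ler1n ltnW.
  by rewrite ler_wpM2l // ltW.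
exists s.+1; rewrite zs /= exprS ler_wpM2l ?(ltW Np) // leNgt; apply/negP => sz.
by have := hs s (ltW sz); rewrite ltnn.
Qed.

(** From exp(w) >= w^k / k! with k gamma >= 8 and kap >= D k!. The power 8 is that of M_n^4 when M_n
    is at most of order n^2. *)
Lemma exp_dominates (gamma D : R) : 0 < gamma -> 0 <= D ->
  exists2 kap : R, 1 <= kap & forall p : R, 1 <= p ->
    D * p ^+ 8 <= expR (kap * p `^ gamma).
Proof.
move=> g0 D0; have [k /= /and3P[k8 k1 _]] := nat_upper [:: 8 / gamma; 1].
have k0 : (0 < k)%N by rewrite -(ltr0n R) (lt_le_trans ltr01).
case: k k8 k1 k0 => // k k8 k1 _.
pose kap := 1 + D * k.+1`!%:R.
have Dk : 0 <= D * k.+1`!%:R by rewrite mulr_ge0 ?ler0n.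
have kap1 : 1 <= kap by rewrite lerDl.
exists kap => // p p1; have p0 : 0 < p by apply: lt_le_trans p1.
have w0 : 0 <= kap * p `^ gamma by rewrite mulr_ge0 ?powR_ge0 // (le_trans _ kap1).
apply: (@le_trans _ _ ((kap * p `^ gamma) ^+ k.+1 / k.+1`!%:R)); last first.
  by apply: le_trans (expR_ge1Dxn k w0); rewrite lerDr.
have fp : 0 < k.+1`!%:R :> R by rewrite ltr0n fact_gt0.
rewrite ler_pdivlMr // exprMn mulrAC; apply: ler_pM => //; first by rewrite exprn_ge0 ?ltW.
  apply: (@le_trans _ _ kap); first by rewrite lerDr.
  by rewrite ler_eXnr.
rewrite -!powR_mulrn ?powR_ge0 ?(ltW p0) // -powRrM ler_powR //.
by move: k8; rewrite ler_pdivrMr // mulrC.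
Qed.

(** Gathers the hypotheses of the giant estimates for [lo n] = C (n+1)^alpha, with further bounds on
    x and on the sums of eps. *)
Record scales (alpha C : R) (ks : nat -> nat) (x eps : nat -> R) : Prop := Scales {
  sc_ks0 : ks 0 = 0%N;
  sc_ksS : forall n, (ks n < ks n.+1)%N;
  sc_x1 : forall n, x n <= 1;
  sc_x2 : forall n, 1 / 2 <= x n;
  sc_xS : forall n, x n.+1 <= x n - (N%:R ^+ (ks n.+1 - ks n))^-1;
  sc_big : forall n, 1 < x n.+1 * N%:R ^+ (ks n.+1 - ks n);
  sc_eps0 : forall n, 0 <= eps n;
  sc_epsS : forall n, (N%:R ^+ (ks n.+1 - ks n)) ^+ 2 * (eps n ^+ 2 +
    expR (- (C * n.+1%:R `^ alpha * x n ^+ 2 / (N%:R ^+ (ks n.+1 - ks n)) ^+ 2))) <= eps n.+1;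
  sc_sum : forall n, \sum_(i < n) eps i <= 1 / 2;
  sc_tail : forall delta, 0 < delta -> exists n0, forall m n, (n0 <= m)%N ->
    \sum_(m <= i < n) eps i <= delta }.

Lemma exists_scales (alpha : R) : 2 < alpha ->
  exists2 C : R, 0 < C & exists ks x eps, scales alpha C ks x eps.
Proof.
move=> a2; have Np := @N_gt0 R N N1.
have N2 : 1 <= N%:R :> R by rewrite ler1n ltnW.
(* b <= (alpha - 2)/4 leaves [gamma] = alpha - 2 - 2b positive, and b <= 1 keeps the sizes at most
   quadratic in n. *)
pose b := Num.min 1 ((alpha - 2) / 4).
have b0 : 0 < b by rewrite lt_min ltr01 divr_gt0 // subr_gt0.
have b1 : b <= 1 by rewrite ge_min lexx.
have b4 : b <= (alpha - 2) / 4 by rewrite ge_min lexx orbT.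
(* Target size of M_n. With y n = (n+1)^(-b), the factor 8/b makes 1/z n at most an eighth of y n -
   y (n+1), so sums of 1/M_n telescope. *)
pose z (n : nat) : R := 8 / b * n.+2%:R `^ (1 + b).
have p1 (n : nat) : 1 <= n.+1%:R :> R by rewrite ler1n.
have z8 n : 8 <= z n.
  rewrite -[leLHS]mulr1; apply: ler_pM => //; first by rewrite ler_pdivlMr //; lra.
  by rewrite -[leLHS](powRr0 n.+2%:R) ler_powR //; lra.
have z1 n : 1 <= z n by apply: le_trans (z8 n); rewrite ler1n.
pose s n := sval (pow_between (z1 n)).
pose M n : R := N%:R ^+ s n.
have zM n : z n <= M n by have /andP[] := svalP (pow_between (z1 n)).
have Mz n : M n <= N%:R * z n by have /andP[] := svalP (pow_between (z1 n)).
have M8 n : 8 <= M n by apply: le_trans (zM n).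
have Mp n : 0 < M n by apply: lt_le_trans (M8 n).
have s0 n : (0 < s n)%N.
  by rewrite lt0n; apply: contraL (M8 n) => /eqP; rewrite /M => ->; rewrite expr0 -ltNge ltr1n.
pose ks n := (\sum_(i < n) s i)%N.
have ksE n : (ks n.+1 - ks n)%N = s n by rewrite /ks big_ord_recr /= addKn.
pose y (n : nat) : R := n.+1%:R `^ (- b).
have y0 n : 0 <= y n by apply: powR_ge0.
have iM n : (M n)^-1 <= (y n - y n.+1) / 8.
  have q0 : 0 < n.+2%:R :> R by rewrite ltr0n.
  have r0 : 0 < n.+1%:R :> R by rewrite ltr0n.
  have yp : 0 < n.+2%:R `^ b :> R by rewrite powR_gt0.
  apply: (@le_trans _ _ (z n)^-1).
    by rewrite lef_pV2 ?posrE // (lt_le_trans _ (z1 n)).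
  have -> : (z n)^-1 = b / n.+2%:R * y n.+1 / 8.
    rewrite /z /y powRD ?powRr1 ?ler0n ?powRN //; last by apply/implyP => _; rewrite gt_eqF.
    by move: yp q0; move: (n.+2%:R : R) => q yp q0; field; rewrite !gt_eqF.
  rewrite ler_wpM2r ?invr_ge0 ?ler0n // lerBrDr.
  have yE (k : nat) : y k = expR (- (b * ln k.+1%:R)) by rewrite /y powR_expR ?mulNr.
  have -> : y n = y n.+1 * expR (b * (ln n.+2%:R - ln n.+1%:R)).
    by rewrite !yE -expRD; congr expR; ring.
  have l : n.+2%:R^-1 <= ln n.+2%:R - ln n.+1%:R :> R.
    have h : -1 < - n.+2%:R^-1 :> R by rewrite ltrN2 invf_lt1 // ltr1n.
    have := le_ln1Dx h; have -> : 1 + - n.+2%:R^-1 = n.+1%:R / n.+2%:R :> R.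
      have -> : n.+2%:R = n.+1%:R + 1 :> R by rewrite natr1.
      by move: (n.+1%:R : R) r0 => r r0; field; apply: lt0r_neq0; lra.
    by rewrite lnM ?posrE ?invr_gt0 // lnV ?posrE // => hh; rewrite -lerN2 opprB.
  have hw := ler_wpM2l (ltW b0) l; have hE := expR_ge1Dx (b * (ln n.+2%:R - ln n.+1%:R)).
  apply: (@le_trans _ _ (y n.+1 * (1 + b / n.+2%:R))).
    by rewrite mulrDr mulr1 addrC lerD2l mulrC.
  by rewrite ler_wpM2l //; apply: le_trans hE; rewrite lerD2l.
have iM0 n : 0 < (M n)^-1 by rewrite invr_gt0.
have yS n : y n.+1 <= y n by have := iM n; have := iM0 n; lra.
have y_mono m n : (m <= n)%N -> y n <= y m.
  elim: n => [|n IHn]; first by case: m.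
  by rewrite leq_eqVlt => /orP[/eqP -> //|mn]; apply: le_trans (yS n) (IHn mn).
(* The recursion reproduces this form: as M_(n+1) <= 4 N M_n, eps (n+1) is at least 1/(1024 N^4
   M_n^2), of which the squared term uses a quarter and the exponential term at most a half. *)
pose eps n : R := (64 * N%:R ^+ 2 * M n ^+ 2)^-1.
have eps0 n : 0 <= eps n by rewrite invr_ge0 !mulr_ge0 ?exprn_ge0 ?ler0n ?ltW.
have epsM n : eps n <= (M n)^-1.
  rewrite lef_pV2 ?posrE ?mulr_gt0 ?exprn_gt0 //.
  apply: (@le_trans _ _ (M n ^+ 2)); first by rewrite ler_eXnr // (le_trans _ (M8 n)) // ler1n.
  rewrite -[leLHS]mul1r ler_wpM2r ?exprn_ge0 ?(ltW (Mp n)) //.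
  by rewrite -[leLHS]mulr1 ler_pM ?exprn_ege1 // ler1n.
have tele m n : (m <= n)%N -> \sum_(m <= i < n) eps i <= (y m - y n) / 8.
  elim: n => [|n IHn]; first by rewrite leqn0 => /eqP ->; rewrite big_geq // subrr mul0r.
  rewrite leq_eqVlt => /orP[/eqP ->|mn]; first by rewrite big_geq // subrr mul0r.
  rewrite big_nat_recr //=; apply: le_trans (lerD (IHn mn) (le_trans (epsM n) (iM n))) _.
  by lra.
(* The loss of x per scale is (y n - y (n+1))/4, which is at least 2/M_n. *)
pose x n : R := 3 / 4 + y n / 4.
have y01 : y 0 = 1 by rewrite /y powR1.
(* The constant in M_n <= D (n+1)^(1+b): N from rounding to a power, 8/b from z, and 4 from
   replacing n+2 by n+1. *)
have [D [DE D0]] : exists D, D = 32 * N%:R / b /\ 0 < D.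
  by exists (32 * N%:R / b); rewrite divr_gt0 ?mulr_gt0.
pose gamma := alpha - 2 - 2 * b; have g0 : 0 < gamma by rewrite /gamma; lra.
have [|kap k1 hk] := @exp_dominates gamma (2048 * N%:R ^+ 4 * D ^+ 4) g0.
  by rewrite !mulr_ge0 ?exprn_ge0 ?ler0n ?(ltW D0).
have k0 : 0 < kap by apply: lt_le_trans k1.
(* In the exponent 4 offsets x^2 >= 1/4 and D^2 offsets M_n^2, leaving at least kap (n+1)^gamma. *)
exists (4 * D ^+ 2 * kap); first by rewrite !mulr_gt0 ?exprn_gt0.
exists ks, x, eps.
have dbl (q r : R) : 0 < q -> 0 <= r -> r <= 2 * q -> r `^ (1 + b) <= 4 * q `^ (1 + b).
  move=> q0 r0 rq; apply: (@le_trans _ _ ((2 * q) `^ (1 + b))).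
    apply: ge0_ler_powR; rewrite ?nnegrE ?addr_ge0 ?(ltW b0) ?(ltW q0) //.
    by rewrite mulr_ge0 ?ltW.
  rewrite powRM ?(ltW q0) // ler_wpM2r ?powR_ge0 //.
  have -> : 4 = 2 `^ 2%:R :> R by rewrite powR_mulrn // -natrX.
  by rewrite ler_powR ?ler1n //; lra.
split=> //.
- by rewrite /ks big_ord0.
- by move=> n; rewrite -subn_gt0 ksE.
- by move=> n; rewrite /x; have := y_mono 0 n (leq0n n); rewrite y01; lra.
- by move=> n; rewrite /x; have := y0 n; lra.
- move=> n; rewrite ksE -/(M n) /x; have := iM n; have := iM0 n; have := yS n; lra.
- move=> n; rewrite ksE -/(M n); apply: (@lt_le_trans _ _ (3 / 4 * 8)); first by lra.
  by apply: ler_pM => //; [lra | rewrite /x; have := y0 n.+1; lra].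
- move=> n; rewrite ksE -/(M n); set P : R := n.+1%:R.
  have P1 : 1 <= P by rewrite ler1n.
  have P0 : 0 < P by apply: lt_le_trans P1.
  have MD : M n <= D * P `^ (1 + b).
    apply: le_trans (Mz n) _; rewrite /z.
    have -> : D * P `^ (1 + b) = N%:R * (8 / b * (4 * P `^ (1 + b))).
      by rewrite DE; field; rewrite gt_eqF.
    rewrite ler_wpM2l ?(ltW Np) // ler_wpM2l ?divr_ge0 ?(ltW b0) //.
    by apply: dbl => //; rewrite ?ler0n // -[n.+2%:R]natr1 -/P; lra.
  have MS : M n.+1 <= 4 * N%:R * M n.
    apply: le_trans (Mz n.+1) _; rewrite [4 * _]mulrC -mulrA ler_wpM2l ?(ltW Np) //.
    apply: le_trans (ler_wpM2l _ (zM n)); rewrite // /z mulrCA ler_wpM2l ?divr_ge0 ?(ltW b0) //.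
    by apply: dbl; rewrite ?ltr0n ?ler0n // -natrM ler_nat mul2n -addnn addnS ltnS leq_addr.
  set E := expR _.
  have PP : P `^ (1 + b) <= P ^+ 2.
    by rewrite -powR_mulrn ?(ltW P0) // ler_powR //; lra.
  have Mn4 : M n ^+ 4 <= D ^+ 4 * P ^+ 8.
    have -> : D ^+ 4 * P ^+ 8 = (D * P ^+ 2) ^+ 4 by ring.
    apply: lerXn2r; rewrite ?nnegrE ?(ltW (Mp n)) ?mulr_ge0 ?exprn_ge0 ?(ltW D0) ?(ltW P0) //.
    by apply: le_trans MD _; rewrite ler_wpM2l ?(ltW D0).
  have hE : E <= (2048 * N%:R ^+ 4 * M n ^+ 4)^-1.
    rewrite /E expRN lef_pV2 ?posrE ?expR_gt0 ?mulr_gt0 ?exprn_gt0 //.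
    apply: (@le_trans _ _ (2048 * N%:R ^+ 4 * D ^+ 4 * P ^+ 8)).
      by rewrite -[leRHS]mulrA ler_wpM2l ?mulr_ge0 ?exprn_ge0 ?ler0n.
    apply: le_trans (hk P P1) _; rewrite ler_expR ler_pdivlMr ?exprn_gt0 //.
    apply: (@le_trans _ _ (kap * P `^ gamma * (D * P `^ (1 + b)) ^+ 2)).
      rewrite ler_wpM2l ?mulr_ge0 ?powR_ge0 ?(ltW k0) //.
      by apply: lerXn2r; rewrite ?nnegrE ?mulr_ge0 ?powR_ge0 ?(ltW (Mp n)) ?(ltW D0).
    have PE : P `^ alpha = P `^ gamma * (P `^ (1 + b)) ^+ 2.
      have pD (r t : R) : P `^ r * P `^ t = P `^ (r + t).
        by rewrite powRD //; apply/implyP => _; rewrite gt_eqF.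
      by rewrite expr2 !pD; congr (_ `^ _); rewrite /gamma; ring.
    have x4 : 1 / 4 <= x n ^+ 2.
      have -> : 1 / 4 = (1 / 2) ^+ 2 :> R by field.
      by apply: lerXn2r; rewrite ?nnegrE /x; have := y0 n; lra.
    rewrite PE.
    apply: (@le_trans _ _ (4 * D ^+ 2 * kap * (P `^ gamma * (P `^ (1 + b)) ^+ 2) * (1 / 4))).
      by rewrite le_eqVlt; apply/orP; left; apply/eqP; field.
    rewrite ler_wpM2l // !mulr_ge0 ?exprn_ge0 ?powR_ge0 ?(ltW D0) ?(ltW k0) //.
  have MM : 0 < M n ^+ 2 by rewrite exprn_gt0.
  have N4 : 0 < N%:R ^+ 4 :> R by rewrite exprn_gt0.
  apply: (@le_trans _ _ ((1024 * N%:R ^+ 4 * M n ^+ 2)^-1)); last first.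
    rewrite lef_pV2 ?posrE ?mulr_gt0 ?exprn_gt0 //.
    apply: (@le_trans _ _ (64 * N%:R ^+ 2 * (4 * N%:R * M n) ^+ 2)).
      rewrite ler_wpM2l ?mulr_ge0 ?exprn_ge0 ?ler0n //.
      by apply: lerXn2r; rewrite ?nnegrE ?mulr_ge0 ?ler0n ?(ltW (Mp _)).
    by rewrite le_eqVlt; apply/orP; left; apply/eqP; ring.
  apply: (@le_trans _ _ (M n ^+ 2 * (eps n ^+ 2 + (2048 * N%:R ^+ 4 * M n ^+ 4)^-1))).
    by rewrite ler_wpM2l ?(ltW MM) // lerD2l.
  have -> : M n ^+ 2 * (eps n ^+ 2 + (2048 * N%:R ^+ 4 * M n ^+ 4)^-1) =
     3 / 4 * (1024 * N%:R ^+ 4 * M n ^+ 2)^-1.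
    by rewrite /eps; field; rewrite !gt_eqF.
  have : 0 < (1024 * N%:R ^+ 4 * M n ^+ 2)^-1 by rewrite invr_gt0 !mulr_gt0.
  by lra.
- move=> n; rewrite -(big_mkord predT eps); apply: le_trans (tele 0 n (leq0n n)) _.
  by rewrite y01; have := y0 n; lra.
- move=> delta d0; have d8 : 0 < (8 * delta)^-1 by rewrite invr_gt0 mulr_gt0.
  have [n0 /= /andP[h _]] := nat_upper [:: ((8 * delta)^-1) `^ (b^-1)].
  exists n0 => m n n0m; have [mn|nm] := leqP m n; last by rewrite big_geq ?ltW // ltnW.
  apply: le_trans (tele m n mn) _; have := y_mono n0 m n0m; have := y0 n.
  suff : y n0 <= 8 * delta by lra.
  rewrite /y powRN -[leRHS]invrK lef_pV2 ?posrE ?powR_gt0 //.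
  have -> : (8 * delta)^-1 = ((8 * delta)^-1 `^ b^-1) `^ b.
    by rewrite -powRrM mulVf ?gt_eqF // powRr1 // ltW.
  apply: ge0_ler_powR; rewrite ?nnegrE ?powR_ge0 ?ler0n ?(ltW b0) //.
  by apply: le_trans h _; rewrite ler_nat.
Qed.

End Scales.

(** * The supercritical regime *)

Section Supercritical.
Context {R : realType} {N : nat}.
Hypothesis N1 : (1 < N)%N.

Lemma expr_small (r delta : R) : 0 <= r -> r < 1 -> 0 < delta ->
  exists n, forall m, (n <= m)%N -> r ^+ m <= delta.
Proof.
move=> r0 r1 d0; have [->|rn] := eqVneq r 0.
  by exists 1%N => m m1; rewrite expr0n eqn0Ngt m1 ltW.
have rp : 0 < r by rewrite lt0r rn.
have h0 : 0 < r^-1 - 1 by rewrite subr_gt0 invf_gt1.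
have [n /= /andP[hn _]] := nat_upper [:: delta^-1 / (r^-1 - 1)].
exists n => m nm; apply: (@le_trans _ _ (r ^+ n)); first by rewrite ler_wiXn2l // ltW.
rewrite -[leLHS]invrK -exprVn -[leRHS]invrK lef_pV2 ?posrE ?exprn_gt0 ?invr_gt0 //.
have := bernoulli_le n (ltW h0); rewrite [1 + (_ - _)]addrC subrK; apply: le_trans.
by move: hn; rewrite ler_pdivrMr // => /le_trans; apply; rewrite lerDr.
Qed.

Lemma supercritical (alpha : R) : 2 < alpha -> exists2 C2s : R, 0 < C2s &
  forall C0 C1 C2 : R, 0 <= C0 -> 0 <= C1 -> C2s < C2 ->
  (forall k, exists K0, forall K (V : finType) (hd : V -> V -> nat) (pe : {set V} -> R) (o : V),
     (K0 <= K)%N -> ultra N K hd -> (forall e, 0 <= pe e <= 1) ->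
     (forall u v, u != v -> pe [set u; v] = @edgep R N (ck C0 C1 C2 alpha) (hd u v)) ->
     1 / 2 <= pr pe (@escapes V hd o o k)) /\
  (forall (delta : R) (r : nat), 0 < delta -> exists k,
     forall K (V : finType) (hd : V -> V -> nat) (pe : {set V} -> R) (o u v : V),
     (k <= K)%N -> ultra N K hd -> (forall e, 0 <= pe e <= 1) ->
     (forall u v, u != v -> pe [set u; v] = @edgep R N (ck C0 C1 C2 alpha) (hd u v)) ->
     (hd o u <= r)%N -> (hd o v <= r)%N ->
     pr pe (fun S => [&& @escapes V hd o u k S, @escapes V hd o v k S &
                         ~~ connect (adj S) u v]) <= delta).
Proof.
move=> a2; have Np := @N_gt0 R N N1; have a0 : 0 <= alpha by lra.
have [C C_gt0 [ks [x [eps sc]]]] := exists_scales N1 a2; exists C => // C0 C1 C2 C00 C10 hC2.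
have C20 : 0 <= C2 by apply: ltW; apply: lt_trans hC2.
case: sc => ks0 ksS x1 x2 xS big eps0 epsS sum_eps tail.
have ks_ge n : (n <= ks n)%N by elim: n => // n IHn; apply: leq_ltn_trans IHn (ksS n).
have x0 n : 0 <= x n by apply: le_trans (x2 n); lra.
pose c := ck C0 C1 C2 alpha.
have c0 j : (0 < j)%N -> 0 <= c j by move=> _; exact: ck_ge0.
(* Since j > ks n >= n, the term C_2 j^alpha is at least C (n+1)^alpha. *)
have lo_c n j : (ks n < j)%N -> C * n.+1%:R `^ alpha <= c j.
  move=> nj; apply: (@le_trans _ _ (C2 * j%:R `^ alpha)); last first.
    by rewrite lerDr addr_ge0 ?mulr_ge0 // ln_ge0N.
  apply: ler_pM; rewrite ?powR_ge0 ?(ltW C_gt0) ?(ltW hC2) //.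
  by apply: ge0_ler_powR; rewrite ?nnegrE ?ler0n // ler_nat (leq_ltn_trans (ks_ge n)).
have lo0 n : 0 <= C * n.+1%:R `^ alpha by rewrite mulr_ge0 ?powR_ge0 // ltW.
split=> [k|delta r d0].
  exists (ks k.+1) => K V hd pe o kK uV pe01 peE.
  apply: (@le_trans _ _ (1 - \sum_(i < k.+2) eps i)).
    by have := sum_eps k.+2; lra.
  apply: le_trans (escapes_ge uV N1 pe01 peE ks0 ksS x1 x0 xS lo_c lo0 eps0 epsS o kK (big k)) _.
  apply: (le_pr pe01) => S /existsP[y /andP[ky oy]]; apply/existsP; exists y.
  by rewrite oy (leq_ltn_trans (ks_ge k)).
pose E : R := expR (- (12 * N%:R ^+ 2)^-1).
have E0 : 0 < E by apply: expR_gt0.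
have E1 : E < 1.
  by rewrite -[ltRHS]expR0 ltr_expR oppr_lt0 invr_gt0 mulr_gt0 ?exprn_gt0.
have q0 : 0 <= @trap_rate R N by rewrite /trap_rate -/E; lra.
have q1 : @trap_rate R N < 1 by rewrite /trap_rate -/E; lra.
(* Budget: delta/3 for edges jumping past a level, delta/3 for bad balls, and delta/6 for each of
   the two trapped clusters. *)
have [L0 hL] : exists n, forall m, (n <= m)%N -> @trap_rate R N ^+ m <= delta / 6.
  by apply: expr_small => //; rewrite divr_gt0.
pose L := L0.+1; have hLL := hL L (leqnSn L0).
have [n1 hn1] : exists n0, forall m n, (n0 <= m)%N -> \sum_(m <= i < n) eps i <= delta / 3.
  by apply: tail; rewrite divr_gt0.
have [n2 hn2] : exists n0, forall m n, (n0 <= m)%N -> \sum_(m <= i < n) eps i <= (1 - E) / 2.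
  by apply: tail; rewrite divr_gt0 // subr_gt0.
have [kr hr] := ck_ratio C00 C10 C20 a0.
pose e := delta / (3 * L%:R).
have e0 : 0 < e by rewrite divr_gt0 // mulr_gt0 ?ltr0n.
(* The next level is taken so far out that the bound of [tail_sum] on jumping past it is at most e,
   uniformly in K. *)
have nxt_ex n : exists m, (n < m)%N && (3 * c (ks n) * (3 / 4) ^+ (ks m - ks n) <= e).
  have cn : 0 <= c (ks n) by apply: ck_ge0.
  have cp : 0 < 1 + 3 * c (ks n) by lra.
  have [|||m hm] := @expr_small (3 / 4) (e / (1 + 3 * c (ks n))); [lra | lra | exact: divr_gt0 |].
  exists (m + ks n).+1; rewrite ltnS (leq_trans (ks_ge n)) ?leq_addl //=.
  have := hm (ks (m + ks n).+1 - ks n)%N _; rewrite leq_subRL; last first.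
    by apply: leq_trans (ks_ge _); rewrite ltnW // ltnS leq_addl.
  rewrite [(ks n + m)%N]addnC => /(_ (leq_trans (leqnSn _) (ks_ge _))).
  rewrite ler_pdivlMr // => h; apply: le_trans h; rewrite mulrC ler_wpM2l ?exprn_ge0 //; lra.
pose nxt n := ex_minn (nxt_ex n).
have nxtP n : (n < nxt n)%N && (3 * c (ks n) * (3 / 4) ^+ (ks (nxt n) - ks n) <= e).
  by rewrite /nxt; case: ex_minnP.
(* The first level is positive and lies beyond all thresholds: n1 and n2 for the tails of eps, kr
   for the growth of c, r for the starting points. *)
pose l i := iter i nxt (n1 + n2 + kr + r).+1.
have lS i : (l i < l i.+1)%N by have /andP[] := nxtP (l i).
have l0i i : (l 0 <= l i)%N by elim: i => // i IHi; apply: leq_trans IHi (ltnW (lS i)).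
have r0 : (r <= ks (l 0))%N by apply: leq_trans (ks_ge _); rewrite /l /= leqW // leq_addl.
have kr0 : (kr <= ks (l 0))%N.
  by apply: leq_trans (ks_ge _); rewrite /l /= leqW // -addnA (leq_trans _ (leq_addl _ _)) ?leq_addr.
have n10 : (n1 <= l 0)%N by rewrite /l /= leqW // -!addnA leq_addr.
have n20 : (n2 <= l 0)%N by rewrite /l /= leqW // -addnA (leq_trans (leq_addl n1 n2)) // leq_addr.
exists (ks (l L)) => K V hd pe o u v kK uV pe01 peE ru rv.
have hr' j : (ks (l 0) <= j)%N -> c j.+1 <= 3 / 2 * c j.
  by move=> j0; apply: hr; apply: leq_trans j0.
have hm j : (0 < j)%N -> c j <= c j.+1 by move=> j0; apply: ck_mono.
have he n : (l 0 <= n)%N -> eps n <= (1 - expR (- (12 * N%:R ^+ 2)^-1)) / 2.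
  by move=> n0; have := hn2 n n.+1 (leq_trans n20 n0); rewrite big_nat1.
have uB : u \in @ball V hd o (ks (l 0)) by rewrite inE (leq_trans ru).
have vB : v \in @ball V hd o (ks (l 0)) by rewrite inE (leq_trans rv).
have hsk i : (i < L)%N ->
    N%:R ^+ ks (l i) * \sum_(j < K.+1 | (ks (l i.+1) < j)%N) c j / N%:R ^+ j <= e.
  move=> _; have /andP[nn he'] := nxtP (l i); apply: le_trans he'.
  have kk : (ks (l 0) <= ks (l i))%N by apply: ks_mono.
  apply: (tail_sum N1 c0 K.+1) => [||j ij].
  - by apply: leq_trans kk; apply: leq_trans (ks_ge _).
  - by apply: ks_mono => //; exact: ltnW.
  - by apply: hr'; apply: leq_trans ij.
have := pr_two_clusters uV N1 c0 pe01 peE ks0 ksS x1 x0 xS lo_c lo0 eps0 epsS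
  (fun i _ => lS i) (ltn0Sn L0) kK (ltn0Sn _) uB vB hr' hm x2 he hsk.
move/le_trans; apply.
have -> : L%:R * e = delta / 3 by rewrite /e; field; rewrite gt_eqF ?ltr0n.
by have := hn1 (l 0) (l L).+1 n10; lra.
Qed.

End Supercritical.

(** * Words *)

Section Words.
Context {N K : nat}.
Implicit Types u v w : {ffun 'I_K -> 'I_N}.

(** Positions are counted from one as in [hdist], and the empty maximum puts equal words at distance
    0. *)
Definition word_hd u v : nat := \max_(i < K | u i != v i) i.+1.

Lemma word_hd_leP u v k : reflect (forall i : 'I_K, (k <= i)%N -> u i = v i) (word_hd u v <= k)%N.
Proof.
apply: (iffP (bigmax_leqP _ _ _)) => h i.
  by move=> ki; apply/eqP; apply: contraTT ki => uv; rewrite -ltnNge; exact: h.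
by move=> uv; rewrite ltnNge; apply: contra uv => /h ->.
Qed.

Lemma card_word_hd u k : (k <= K)%N -> #|[set v | (word_hd u v <= k)%N]| = (N ^ k)%N.
Proof.
move=> kK; pose F (i : 'I_K) : pred 'I_N := if (i < k)%N then predT else pred1 (u i).
have -> : #|[set v | (word_hd u v <= k)%N]| = #|family F|.
  apply: eq_card => v; rewrite inE; apply/word_hd_leP/familyP => h i.
    by rewrite /F; case: ltnP => // ki; rewrite inE h.
  by move=> ki; have := h i; rewrite /F ltnNge ki inE => /eqP.
rewrite card_family foldrE big_map big_enum /=.
rewrite (eq_bigr (fun i : 'I_K => if (i < k)%N then N else 1%N)) => [|i _].
  by rewrite -big_mkcond /= -(big_ord_widen K (fun=> N) kK) prod_nat_const card_ord.
by rewrite /F; case: ifP => _; [rewrite card_ord | rewrite card1].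
Qed.

Lemma ultra_words : ultra N K word_hd.
Proof.
split=> [u v|u v|v u w|u v|u k].
- rewrite -leqn0; apply/word_hd_leP/eqP => [h|-> //]; by apply/ffunP => i; apply: h.
- by apply: eq_bigl => i; rewrite eq_sym.
- apply/word_hd_leP => i; rewrite geq_max => /andP[h1 h2].
  have /word_hd_leP/(_ i h1) -> := leqnn (word_hd u v).
  by have /word_hd_leP/(_ i h2) := leqnn (word_hd v w).
- by apply/word_hd_leP => i; rewrite leqNgt ltn_ord.
- exact: card_word_hd.
Qed.

End Words.

From mathcomp Require Import all_classical all_reals all_analysis.
Local Open Scope classical_set_scope.
Local Open Scope ring_scope.

(** * Transfer to the infinite graph *)

Section Law.
Context {R : realType} {d : measure_display} {T : measurableType d} (P : probability T R).
Context {I : finType} (A : I -> set T) (p : I -> R).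
Hypothesis mA : forall i, measurable (A i).
Hypothesis pA : forall J : {set I},
  P [set w | forall i, i \in J -> A i w] = (\prod_(i in J) p i)%:E.

Definition cfg w : {set I} := finset (fun i => `[< A i w >]).

Let cyl (J : {set I}) (s : seq I) : set T :=
  [set w | (forall i, i \in J -> A i w) /\ (forall i, i \in s -> ~ A i w)].

Lemma measurable_cyl (J : {set I}) (s : seq I) : measurable (cyl J s).
Proof.
apply: measurableI.
  have := @fin_bigcap_measurable _ T I [set` J] A; apply => [|i _]; last exact: mA.
  exact: finite_finset.
have := @fin_bigcap_measurable _ T I [set` s] (fun i => ~` A i); apply => [|i _].
  exact: finite_finset.
by apply: measurableC; exact: mA.
Qed.

(** Independence is given for intersections of the events themselves; complements are added one at a
    time through P(B minus A) = P(B) - P(B and A). *)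
Lemma pr_cyl (J : {set I}) (s : seq I) : uniq s -> (forall i, i \in s -> i \notin J) ->
  P (cyl J s) = (\prod_(i in J) p i * \prod_(i <- s) (1 - p i))%:E.
Proof.
elim: s J => [|i s IHs] J /=.
  move=> _ _; rewrite big_nil mulr1 -pA; congr (P _); apply/seteqP; split => w /=.
    by case.
  by move=> h; split.
move=> /andP[is_ us] hJ.
have iJ : i \notin J by apply: hJ; rewrite inE eqxx.
have hJs j : j \in s -> j \notin J by move=> js; apply: hJ; rewrite inE js orbT.
have -> : cyl J (i :: s) = cyl J s `\` A i.
  apply/seteqP; split => w /=.
    move=> [h1 h2]; split; last by apply: h2; rewrite inE eqxx.
    by split=> // j js; apply: h2; rewrite inE js orbT.
  by move=> [[h1 h2] h3]; split=> // j; rewrite inE => /predU1P[->|/h2].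
have -> : P (cyl J s `\` A i) = (P (cyl J s) - P (cyl J s `&` A i))%E.
  apply: measureD => //; first exact: measurable_cyl.
  by rewrite ltey_eq fin_num_measure //; exact: measurable_cyl.
have -> : cyl J s `&` A i = cyl (i |: J)%SET s.
  apply/seteqP; split => w /=.
    by move=> [[h1 h2] h3]; split=> // j; rewrite !inE => /predU1P[->|/h1].
  move=> [h1 h2]; split; last by apply: h1; rewrite !inE eqxx.
  by split=> // j jJ; apply: h1; rewrite !inE jJ orbT.
rewrite !IHs //; last first.
  move=> j js; rewrite !inE negb_or hJs // andbT.
  by apply: contraNneq is_ => <-.
rewrite big_setU1 //= big_cons -EFinB; congr EFin.
by rewrite mulrBl mul1r mulrBr !mulrA [p i * _]mulrC.
Qed.

Lemma cfg_eq S : [set w | cfg w = S] = cyl S (enum (~: S)%SET).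
Proof.
apply/seteqP; split => w /=.
  move=> <-; split=> i; first by rewrite inE => /asboolP.
  by rewrite mem_enum !inE => /asboolPn.
move=> [h1 h2]; apply/setP => i; rewrite inE; case: (boolP (i \in S)) => iS.
  by apply/asboolP; exact: h1.
by apply/asboolPn; apply: h2; rewrite mem_enum inE.
Qed.

Lemma measurable_cfg_eq S : measurable [set w | cfg w = S].
Proof. by rewrite cfg_eq; exact: measurable_cyl. Qed.

Lemma law_cfg_eq S : P [set w | cfg w = S] = (wt p S)%:E.
Proof.
rewrite cfg_eq pr_cyl ?enum_uniq // => [|i]; last by rewrite mem_enum inE.
rewrite big_enum /=; congr EFin; rewrite /wt [RHS](bigID (mem S)) /=; congr (_ * _).
  by apply: eq_bigr => i ->.
by apply: eq_big => [i|i]; [rewrite inE | rewrite inE => /negbTE ->].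
Qed.

(** The configuration has the product law of the finite estimates: atoms are cylinders, and every
    event is a finite disjoint union of atoms. *)
Lemma law_cfg (F : pred {set I}) :
  measurable [set w | F (cfg w)] /\ P [set w | F (cfg w)] = (pr p F)%:E.
Proof.
suff h s : uniq s -> measurable [set w | cfg w \in s] /\
    P [set w | cfg w \in s] = (\sum_(S <- s) wt p S)%:E.
  have [h1 h2] := h (enum F) (enum_uniq _).
  have e : [set w | F (cfg w)] = [set w | cfg w \in enum F].
    by apply/seteqP; split => w /=; rewrite mem_enum.
  by rewrite e; split=> //; rewrite h2 big_enum.
elim: s => [_|S s IHs /= /andP[Ss us]].
  have -> : [set w | cfg w \in [::]] = set0 by apply/seteqP; split => w //=.
  by rewrite big_nil measure0; split.
have [h1 h2] := IHs us.
have -> : [set w | cfg w \in S :: s] = [set w | cfg w = S] `|` [set w | cfg w \in s].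
  apply/seteqP; split => w /=; first by rewrite inE => /predU1P[->|->]; [left|right].
  by rewrite inE => -[->|->]; rewrite ?eqxx ?orbT.
split; first by apply: measurableU => //; exact: measurable_cfg_eq.
have -> : P ([set w | cfg w = S] `|` [set w | cfg w \in s]) =
    (P [set w | cfg w = S] + P [set w | cfg w \in s])%E.
  apply: measureU => //; first exact: measurable_cfg_eq.
  by apply/seteqP; split => w //= -[->]; rewrite (negbTE Ss).
by rewrite law_cfg_eq h2 big_cons EFinD.
Qed.

End Law.

(** * Continuity of the measure along growing balls *)

Section Limits.
Context {R : realType} {d : measure_display} {T : measurableType d} (P : probability T R).

(** E lies in the increasing union of the tail intersections of F, whose measures converge to that
    of the union. *)
Lemma measure_le_eventually (E : set T) (F : nat -> set T) (k : nat) (delta : R) :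
  measurable E -> (forall n, measurable (F n)) ->
  (forall w, E w -> exists K, forall n, (K <= n)%N -> F n w) ->
  (forall n, (k <= n)%N -> (P (F n) <= delta%:E)%E) -> (P E <= delta%:E)%E.
Proof.
move=> mE mF EF hd.
pose G K := \bigcap_(n in [set n | (K <= n)%N]) F n.
have mG K : measurable (G K).
  by apply: bigcap_measurable => [|n _]; [exists K => /= | exact: mF].
have EG : E `<=` \bigcup_K G K.
  by move=> w /EF[K h]; exists K => // n /= Kn; exact: h.
have mUG : measurable (\bigcup_K G K) by apply: bigcupT_measurable.
apply: (@le_trans _ _ (P (\bigcup_K G K))); first by apply: le_measure; rewrite ?inE.
have homo : {homo G : n m / (n <= m)%N >-> (n <= m)%O}.
  move=> n m nm; apply/subsetPset => w h i /= mi; apply: h => /=; exact: leq_trans mi.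
have cv := nondecreasing_cvg_mu (mu := P) mG mUG homo.
rewrite -(cvg_lim _ cv) //; apply: lime_le; first by apply/cvg_ex; exists (P (\bigcup_K G K)).
near=> K => /=; apply: le_trans (hd (maxn K k) (leq_maxr _ _)).
apply: le_measure; rewrite ?inE //.
by move=> w h; apply: h => /=; exact: leq_maxl.
Unshelve. all: by end_near. Qed.

(** Continuity from above: the unions over n decrease with k, and each has probability at least
    delta. *)
Lemma measure_ge_infinitely (E : nat -> nat -> set T) (delta : R) :
  (forall k n, measurable (E k n)) -> (forall k n, E k.+1 n `<=` E k n) ->
  (forall k, exists n, (delta%:E <= P (E k n))%E) ->
  (delta%:E <= P (\bigcap_k \bigcup_n E k n))%E.
Proof.
move=> mE sE hd; pose G k := \bigcup_n E k n.
have mG k : measurable (G k) by apply: bigcupT_measurable.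
have mI : measurable (\bigcap_k G k) by apply: bigcapT_measurable.
have homo : {homo G : n m / (n <= m)%N >-> (m <= n)%O}.
  apply/nonincreasing_seqP => n; apply/subsetPset => w [i _ h]; exists i => //; exact: sE.
have fin0 : (P (G 0%N) < +oo)%E by rewrite ltey_eq fin_num_measure.
have cv := nonincreasing_cvg_mu (mu := P) fin0 mG mI homo.
rewrite -/(G) -(cvg_lim _ cv) //; apply: lime_ge; first by apply/cvg_ex; exists (P (\bigcap_k G k)).
near=> K => /=; have [n h] := hd K; apply: le_trans h _.
by apply: le_measure; rewrite ?inE //; exact: bigcup_sup.
Unshelve. all: by end_near. Qed.

End Limits.

(** * Words as balls around the origin *)

Section Embedding.
Context {N : nat}.
Hypothesis N1 : (1 < N)%N.
Implicit Types (x y : Omega N) (K : nat).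

Lemma word_proof K (u : {ffun 'I_K -> 'I_N}) :
  let s i := if insub i is Some j then nat_of_ord (u j) else 0%N in
  (forall i, (s i < N)%N) /\ exists M, forall i, (M <= i)%N -> s i = 0%N.
Proof.
split=> [i|]; first by case: insubP => [j _ _|_]; [exact: ltn_ord | exact: ltnW].
by exists K => i Ki; rewrite insubN // -leqNgt.
Qed.

Definition emb K (u : {ffun 'I_K -> 'I_N}) : Omega N := exist _ _ (word_proof u).
Definition restr K x : {ffun 'I_K -> 'I_N} := [ffun i : 'I_K => Ordinal ((svalP x).1 i)].
Definition supp x k := forall i, (k <= i)%N -> sval x i = 0%N.

Lemma emb_val K (u : {ffun 'I_K -> 'I_N}) (i : 'I_K) : sval (emb u) i = u i :> nat.
Proof. by rewrite /= valK. Qed.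

Lemma emb_val0 K (u : {ffun 'I_K -> 'I_N}) i : (K <= i)%N -> sval (emb u) i = 0%N.
Proof. by move=> Ki; rewrite /= insubN // -leqNgt. Qed.

Lemma omega_eq x y : (forall i, sval x i = sval y i) -> x = y.
Proof.
case: x y => [x px] [y py] /= xy; apply: eq_exist; exact/funext.
Qed.

Lemma embK K (u : {ffun 'I_K -> 'I_N}) : restr K (emb u) = u.
Proof. by apply/ffunP => i; rewrite ffunE; apply/val_inj; rewrite /= valK. Qed.

Lemma restrK K x : supp x K -> emb (restr K x) = x.
Proof.
move=> sx; apply: omega_eq => i; have [iK|Ki] := ltnP i K.
  by rewrite (emb_val (restr K x) (Ordinal iK)) ffunE.
by rewrite emb_val0 // sx.
Qed.

Lemma supp_exists x : exists k, supp x k.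
Proof. exact: (svalP x).2. Qed.

Lemma suppS x k l : (k <= l)%N -> supp x k -> supp x l.
Proof. by move=> kl sx i li; apply: sx; exact: leq_trans li. Qed.

Lemma supp_emb K (u : {ffun 'I_K -> 'I_N}) : supp (emb u) K.
Proof. by move=> i; exact: emb_val0. Qed.

Lemma hdist_emb K (u v : {ffun 'I_K -> 'I_N}) : u != v -> hdist (emb u) (emb v) (word_hd u v).
Proof.
move=> uv; have uU := @ultra_words N K.
have h0 : (0 < word_hd u v)%N by rewrite lt0n (hd_eq0 uU).
have eqi k (i : nat) : (word_hd u v <= k)%N -> (k <= i)%N -> sval (emb u) i = sval (emb v) i.
  move=> uvk ki; have [iK|Ki] := ltnP i K; last by rewrite !emb_val0.
  rewrite (emb_val u (Ordinal iK)) (emb_val v (Ordinal iK)); congr nat_of_ord.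
  by have /word_hd_leP := uvk; apply.
split=> //; split=> [e|i]; last exact: eqi.
have : (word_hd u v <= (word_hd u v).-1)%N.
  apply/word_hd_leP => i; rewrite leq_eqVlt => /orP[/eqP ei|li].
    by apply/val_inj; rewrite /= -!emb_val -ei.
  have /word_hd_leP := leqnn (word_hd u v); apply; by rewrite -(prednK h0).
by rewrite leqNgt prednK // leqnn.
Qed.

Lemma word_hd_origin K x k : supp x K -> (word_hd (restr K (origin N1)) (restr K x) <= k)%N <-> supp x k.
Proof.
move=> sx; split=> [/word_hd_leP h i ki|h].
  have [iK|Ki] := ltnP i K; last exact: sx.
  have := h (Ordinal iK) ki; rewrite !ffunE => /(congr1 val) /= <-.
  by [].
by apply/word_hd_leP => i ki; rewrite !ffunE; apply/val_inj; rewrite /= h.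
Qed.

(** Balls around the origin are finite and exhaust the space; hence a cluster is infinite exactly
    when it leaves every ball. *)
Lemma finite_supp (C : set (Omega N)) : finite_set C <-> exists k, forall x, C x -> supp x k.
Proof.
split=> [fC|[k hk]].
  pose h x := projT1 (cid (supp_exists x)).
  have hP x : supp x (h x) by rewrite /h; case: cid.
  have /finite_seqP[s es] := finite_image h fC.
  exists (\max_(i <- s) i)%N => x Cx; apply: suppS (hP x).
  have : h x \in s by have : (h @` C) (h x) by [exists x]; rewrite es.
  by move=> hs; rewrite (big_rem _ hs) /= leq_maxl.
apply: (@sub_finite_set _ _ (range (@emb k))).
  by move=> x Cx; exists (restr k x) => //; apply: restrK; exact: hk.
by apply: finite_image; exact: finite_finset.
Qed.

End Embedding.

(** * From events in balls to events of the infinite graph *)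

Section Transfer.
Context {R : realType} {d : measure_display} {T : measurableType d} (P : probability T R).
Context {N : nat}.
Hypothesis N1 : (1 < N)%N.
Context (c : nat -> R) (edge : Omega N -> Omega N -> set T).
Hypothesis model : hier_model c P edge.
Local Notation word K := ({ffun 'I_K -> 'I_N}).
Local Notation emb := (emb N1).
Local Notation origin := (origin N1).

(** Indexed by all sets of words, as the product measure requires; a set that is not a pair gets the
    empty event. *)
Definition edge_set K (e : {set word K}) : set T :=
  [set w | exists u v, [/\ u != v, e = finset.setU [set u]%SET [set v]%SET & edge (emb u) (emb v) w]].
Definition edge_pr K (e : {set word K}) : R := fine (P (edge_set e)).
Definition config K (w : T) : {set {set word K}} := cfg (@edge_set K) w.

Lemma edge_set2 K (u v : word K) : u != v ->
  edge_set (finset.setU [set u]%SET [set v]%SET) = edge (emb u) (emb v).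
Proof.
have [_ sym _ _] := model; move=> uv; apply/seteqP; split => w /=; last by exists u, v.
case=> u' [v' [uv' e h]]; have [euv|nuv] := eqVneq u v'.
  have nvu : v != v' by rewrite -euv eq_sym.
  rewrite finset.setUC in e; have := uv'.
  have : v \in finset.setU [set u']%SET [set v']%SET by rewrite -e !inE eqxx.
  by rewrite !inE (negbTE nvu) orbF => /eqP -> _; rewrite sym euv.
have : u \in finset.setU [set u']%SET [set v']%SET by rewrite -e !inE eqxx.
rewrite !inE (negbTE nuv) orbF => /eqP eu; subst u'.
have : v \in finset.setU [set u]%SET [set v']%SET by rewrite -e !inE eqxx orbT.
by rewrite !inE eq_sym (negbTE uv) /= => /eqP ->.
Qed.

Lemma edge_setE K (e : {set word K}) :
  (exists u v, [/\ u != v, e = finset.setU [set u]%SET [set v]%SET &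
     edge_set e = edge (emb u) (emb v)]) \/ edge_set e = set0.
Proof.
have [[u [v [uv ee]]]|np] := pselect (exists u v, u != v /\ e = finset.setU [set u]%SET [set v]%SET).
  by left; exists u, v; split=> //; rewrite ee edge_set2.
right; apply/seteqP; split => w //= -[u [v [uv ee _]]]; apply: np; by exists u, v.
Qed.

Lemma measurable_edge_set K (e : {set word K}) : measurable (edge_set e).
Proof.
have [me _ _ _] := model.
by have [[u [v [_ _ ->]]]|->] := edge_setE e.
Qed.

Lemma edge_prE K (e : {set word K}) : P (edge_set e) = (edge_pr e)%:E.
Proof. by rewrite fineK // fin_num_measure //; exact: measurable_edge_set. Qed.

Lemma edge_pr01 K (e : {set word K}) : 0 <= edge_pr e <= 1.
Proof.
rewrite -!lee_fin -edge_prE measure_ge0 probability_le1 //.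
exact: measurable_edge_set.
Qed.

Lemma edge_pr2 K (u v : word K) : u != v ->
  edge_pr (finset.setU [set u]%SET [set v]%SET) = @edgep R N c (word_hd u v).
Proof.
have [_ _ hP _] := model; move=> uv.
by rewrite /edge_pr edge_set2 // (hP _ _ _ (hdist_emb N1 uv)).
Qed.

Lemma emb_inj K : injective (@emb K).
Proof. by move=> u v /(congr1 (restr K)); rewrite !embK. Qed.

(** If J contains a set with empty event, both sides vanish. Otherwise endpoints are chosen for each
    member, and distinct members give pairs that differ even up to exchange, as the independence in
    [hier_model] asks. *)
Lemma edge_set_law K (J : {set {set word K}}) :
  P [set w | forall e, e \in J -> edge_set e w] = (\prod_(e in J) edge_pr e)%:E.
Proof.
have [_ sym _ hI] := model.
have [[e [eJ e0]]|np] := pselect (exists e, e \in J /\ edge_set e = set0).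
  rewrite (_ : [set w | _] = set0) ?measure0; last first.
    by apply/seteqP; split => w //= /(_ e eJ); rewrite e0.
  by rewrite (bigD1 e) //= /edge_pr e0 measure0 /= mul0r.
pose q0 := (restr K origin, restr K origin).
pose q e : word K * word K :=
  xget q0 [set q | [/\ q.1 != q.2, e = finset.setU [set q.1]%SET [set q.2]%SET &
                      edge_set e = edge (emb q.1) (emb q.2)]].
have qP e : e \in J -> [/\ (q e).1 != (q e).2, e = finset.setU [set (q e).1]%SET [set (q e).2]%SET &
                      edge_set e = edge (emb (q e).1) (emb (q e).2)].
  move=> eJ; rewrite /q; case: xgetP => [p _ //|none].
  have [[u [v [h1 h2 h3]]]|e0] := edge_setE e; last by exfalso; apply: np; exists e.
  by exfalso; apply: (none (u, v)).
pose s := enum J.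
pose f i := (emb (q (nth finset.set0 s i)).1, emb (q (nth finset.set0 s i)).2).
have sJ i : (i < size s)%N -> nth finset.set0 s i \in J.
  by move=> i_s; rewrite -mem_enum mem_nth.
have := hI (size s) f; rewrite /f /= => h.
have -> : [set w | forall e, e \in J -> edge_set e w] =
    \bigcap_(i in `I_(size s)) edge (f i).1 (f i).2.
  apply/seteqP; split => w /=.
    by move=> hw i /= /sJ ei; have [_ _ <-] := qP _ ei; exact: hw.
  move=> hw e eJ; have es : e \in s by rewrite mem_enum.
  have := hw (index e s); rewrite /= index_mem es nth_index // => /(_ isT).
  by have [_ _ ->] := qP _ eJ.
rewrite h.
- have -> : \prod_(e in J) edge_pr e = \prod_(i < size s) edge_pr (nth finset.set0 s i).
    by rewrite -[LHS]big_enum (big_nth finset.set0) big_mkord.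
  rewrite -prodEFin.
  apply: eq_bigr => i _; have [_ _ <-] := qP _ (sJ i (ltn_ord i)).
  exact: edge_prE.
- move=> i /sJ ei; have [h1 _ _] := qP _ ei; move/emb_inj => e1.
  by rewrite e1 eqxx in h1.
- move=> i j hi hj ij; have [_ h2 _] := qP _ (sJ i hi); have [_ h2' _] := qP _ (sJ j hj).
  have nij : nth finset.set0 s i != nth finset.set0 s j.
    by rewrite nth_uniq ?enum_uniq //; apply/eqP.
  split=> ee; have /= /emb_inj e1 := congr1 fst ee; have /= /emb_inj e2 := congr1 snd ee;
    move/eqP: nij; apply; rewrite h2 h2' e1 e2 //.
  exact: finset.setUC.
Qed.

Lemma config_law K (F : pred {set {set word K}}) :
  measurable [set w | F (config K w)] /\
  P [set w | F (config K w)] = (pr (@edge_pr K) F)%:E.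
Proof. exact: (law_cfg (@measurable_edge_set K) (@edge_set_law K)). Qed.

Lemma adj_config K w (u v : word K) :
  adj (config K w) u v <-> u != v /\ edge (emb u) (emb v) w.
Proof.
rewrite /adj /config /cfg; split=> [/andP[uv]|[uv h]].
  by rewrite inE => /asboolP; rewrite edge_set2.
by rewrite uv /= inE; apply/asboolP; rewrite edge_set2.
Qed.

Lemma conn_cons w x y z : edge x y w -> conn edge w y z -> conn edge w x z.
Proof.
move=> xy [n [f [f0 fn h]]]; exists n.+1, (fun i => if i is j.+1 then f j else x); split=> //.
by case=> [|i] /= i_n; [rewrite f0 | exact: h].
Qed.

Lemma connect_conn K w (u v : word K) :
  connect (adj (config K w)) u v -> conn edge w (emb u) (emb v).
Proof.
move=> /connectP[p pp ->]; elim: p u pp => [|z p IHp] u /=.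
  by move=> _; exists 0%N, (fun=> emb u).
by move=> /andP[/adj_config[_ uz] pz]; apply: conn_cons uz (IHp z pz).
Qed.

Lemma conn_connect w x y : conn edge w x y -> exists K0, forall K, (K0 <= K)%N ->
  connect (adj (config K w)) (restr K x) (restr K y).
Proof.
move=> [n [f [<- <- h]]]; elim: n h => [|n IHn] h; first by exists 0%N => K _; exact: connect0.
have [|K0 hK0] := IHn; first by move=> i i_n; apply: h; rewrite ltnS ltnW.
have [k1 s1] := supp_exists (f n); have [k2 s2] := supp_exists (f n.+1).
exists (maxn K0 (maxn k1 k2)) => K; rewrite !geq_max => /and3P[kK k1K k2K].
apply: connect_trans (hK0 K kK) _.
(* A step of the path may stay at the same point, where [adj] fails. *)
have [-> |ne] := eqVneq (restr K (f n)) (restr K (f n.+1)); first exact: connect0.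
apply: connect1; apply/adj_config; split=> //.
by rewrite !restrK; [exact: h | exact: suppS s2 | exact: suppS s1].
Qed.

Definition esc K k x : set T :=
  [set w | @escapes (word K) word_hd (restr K origin) (restr K x) k (config K w)].

(** A point of the cluster outside the ball of radius k is joined to x by a finite path, which lies
    in every large enough ball. *)
Lemma infinite_esc w x k : ~ finite_set (Defs.cluster edge w x) ->
  exists K0, forall K, (K0 <= K)%N -> esc K k x w.
Proof.
move=> /(finite_supp N1) nf.
have [y xy ny] : exists2 y, conn edge w x y & ~ supp y k.
  apply: contrapT => h; apply: nf; exists k => y xy; apply: contrapT => ny.
  by apply: h; exists y.
have [K0 hK0] := conn_connect xy; have [k1 s1] := supp_exists y.
exists (maxn K0 k1) => K; rewrite geq_max => /andP[h0 h1].
apply/existsP; exists (restr K y); rewrite hK0 // andbT ltnNge.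
by apply/negP => /(word_hd_origin N1 k (suppS h1 s1)).
Qed.

(** The shift by r keeps x inside all the balls considered, so that [restr] loses nothing. *)
Lemma esc_infinite w x r : supp x r ->
  (forall k, exists n, esc (r + n) k x w) -> ~ finite_set (Defs.cluster edge w x).
Proof.
move=> sx h /(finite_supp N1)[k hk]; have [n /existsP[y /andP[ky xy]]] := h k.
have := hk (emb y); rewrite /Defs.cluster /= => /(_ _)/(word_hd_origin N1 k (supp_emb N1 y)).
rewrite embK leqNgt ky => hh; suff : false by []; apply: hh.
rewrite -(restrK N1 (suppS (leq_addr n r) sx)); exact: connect_conn.
Qed.

Lemma measurable_infinite x : measurable [set w | ~ finite_set (Defs.cluster edge w x)].
Proof.
have [r sx] := supp_exists x.
have -> : [set w | ~ finite_set (Defs.cluster edge w x)] = \bigcap_k \bigcup_n esc (r + n) k x.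
  apply/seteqP; split => w /=.
    by move=> /infinite_esc h k _; have [n hn] := h k; exists n => //; apply: hn; rewrite leq_addl.
  by move=> h; apply: (esc_infinite sx) => k; have [n _ hn] := h k I; exists n.
apply: bigcapT_measurable => k; apply: bigcupT_measurable => n; exact: (config_law _).1.
Qed.

Lemma measurable_conn x y : measurable [set w | conn edge w x y].
Proof.
have [r1 sx] := supp_exists x; have [r2 sy] := supp_exists y.
have -> : [set w | conn edge w x y] = \bigcup_n
   [set w | connect (adj (config (r1 + r2 + n) w)) (restr _ x) (restr _ y)].
  apply/seteqP; split => w /=.
    by move=> /conn_connect[K hK]; exists K => //=; apply: hK; rewrite leq_addl.
  move=> [n _ /connect_conn]; rewrite !restrK //.
    by apply: suppS sy; rewrite addnAC leq_addl.
  by apply: suppS sx; rewrite -addnA leq_addr.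
apply: bigcupT_measurable => n.
exact: (config_law (fun S => connect (adj S) (restr _ x) (restr _ y))).1.
Qed.

(** An infinite cluster escapes from radius k in all large balls, so its probability is at most
    every delta > 0; taking half of a positive probability gives the contradiction. *)
Lemma not_percolates :
  (forall delta : R, 0 < delta -> exists k, forall K, (k <= K)%N ->
     pr (@edge_pr K) (@escapes (word K) word_hd (restr K origin) (restr K origin) k) <= delta) ->
  ~ percolates N1 P edge.
Proof.
move=> h; rewrite /percolates; set E := [set w | _] => PE.
have mE : measurable E := measurable_infinite origin.
have fE : P E \is a fin_num by apply: fin_num_measure.
have d0 : 0 < fine (P E) / 2 by rewrite divr_gt0 // -lte_fin fineK.
have [k hk] := h _ d0.
have : (P E <= (fine (P E) / 2)%:E)%E.
  apply: (@measure_le_eventually _ _ _ _ _ (fun K => esc K k origin) k) => //.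
  - by move=> n; exact: (config_law _).1.
  - by move=> w; exact: infinite_esc.
  - by move=> n kn; rewrite (config_law _).2 lee_fin; exact: hk.
rewrite -{1}(fineK fE) lee_fin leNgt ltr_pdivrMr // ltr_pMr ?ltr1n //.
by rewrite -lte_fin fineK.
Qed.

(** The events of escaping from radius k in some ball decrease with k, and on their intersection the
    cluster of the origin is infinite. *)
Lemma percolates_of_escapes :
  (forall k, exists K0, forall K, (K0 <= K)%N ->
     1 / 2 <= pr (@edge_pr K) (@escapes (word K) word_hd (restr K origin) (restr K origin) k)) ->
  percolates N1 P edge.
Proof.
move=> h; rewrite /percolates.
apply: (@lt_le_trans _ _ ((1 / 2 : R)%:E)); first by rewrite lte_fin divr_gt0.
have mE k n : measurable (esc n k origin) by exact: (config_law _).1.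
apply: (@le_trans _ _ (P (\bigcap_k \bigcup_n esc n k origin))).
  apply: measure_ge_infinitely => //.
    move=> k n w /existsP[y /andP[ky oy]]; apply/existsP; exists y.
    by rewrite oy (ltnW ky).
  by move=> k; have [n hn] := h k; exists n; rewrite (config_law _).2 lee_fin; exact: hn.
apply: le_measure; rewrite ?inE //.
- by apply: bigcapT_measurable => k; apply: bigcupT_measurable.
- exact: measurable_infinite.
move=> w hw; apply: (@esc_infinite w origin 0) => // k.
by have [n _ hn] := hw k I; exists n.
Qed.

(** For fixed x and y the event is null by the finite bound; the union over pairs is countable
    because words of all lengths enumerate Omega_N. *)
Lemma unique_of_escapes :
  (forall (delta : R) (r : nat), 0 < delta -> exists k, forall K (u v : word K), (k <= K)%N ->
     (word_hd (restr K origin) u <= r)%N -> (word_hd (restr K origin) v <= r)%N ->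
     pr (@edge_pr K) (fun S => [&& @escapes (word K) word_hd (restr K origin) u k S,
       @escapes (word K) word_hd (restr K origin) v k S & ~~ connect (adj S) u v]) <= delta) ->
  unique_infinite_cluster P edge.
Proof.
move=> h; pose D x y := [set w | [/\ ~ finite_set (Defs.cluster edge w x),
   ~ finite_set (Defs.cluster edge w y) & ~ conn edge w x y]].
have mD x y : measurable (D x y).
  have -> : D x y = [set w | ~ finite_set (Defs.cluster edge w x)] `&`
      ([set w | ~ finite_set (Defs.cluster edge w y)] `\` [set w | conn edge w x y]).
    by apply/seteqP; split => w /= [] // ? [].
  apply: measurableI; first exact: measurable_infinite.
  by apply: measurableD; [exact: measurable_infinite | exact: measurable_conn].
have D0 x y : P (D x y) = 0%E.
  apply/eqP; rewrite eq_le measure_ge0 andbT; apply/lee_addgt0Pr => delta d0; rewrite add0e.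
  have [r1 sx] := supp_exists x; have [r2 sy] := supp_exists y; pose r := maxn r1 r2.
  have [k hk] := h delta r d0.
  pose F K := [set w | [&& @escapes (word K) word_hd (restr K origin) (restr K x) k (config K w),
     @escapes (word K) word_hd (restr K origin) (restr K y) k (config K w) &
     ~~ connect (adj (config K w)) (restr K x) (restr K y)]].
  have lawF K := config_law (fun S : {set {set word K}} => [&& @escapes (word K) word_hd (restr K origin) (restr K x) k S,
     @escapes (word K) word_hd (restr K origin) (restr K y) k S &
     ~~ connect (adj S) (restr K x) (restr K y)]).
  have sK z K : (r <= K)%N -> supp z r -> (word_hd (restr K origin) (restr K z) <= r)%N.
    by move=> rK sz; apply/(word_hd_origin N1); [exact: suppS sz | ].
  have sxr : supp x r by apply: suppS sx; exact: leq_maxl.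
  have syr : supp y r by apply: suppS sy; exact: leq_maxr.
  apply: (@measure_le_eventually _ _ _ _ _ F (maxn k r)) => //.
  - by move=> n; exact: (lawF n).1.
  - move=> w [ix iy nc]; have [K1 h1] := infinite_esc k ix; have [K2 h2] := infinite_esc k iy.
    exists (maxn r (maxn K1 K2)) => K; rewrite geq_max => /andP[rK].
    rewrite geq_max => /andP[K1K K2K].
    apply/and3P; split; [exact: h1 | exact: h2 | apply/negP => /connect_conn].
    by rewrite (restrK N1 (suppS rK sxr)) (restrK N1 (suppS rK syr)).
  - move=> K; rewrite geq_max => /andP[kK rK].
    by rewrite (lawF K).2 lee_fin; apply: hk => //; exact: sK.
pose code := {K : nat & (word K * word K)%type}.
pose G n := if unpickle n is Some p then
  D (emb (projT2 (p : code)).1) (emb (projT2 (p : code)).2) else set0.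
rewrite /unique_infinite_cluster; set U := [set w | _].
have UG : U = \bigcup_n G n.
  apply/seteqP; split => w /=.
    move=> [x [y [ix iy nc]]].
    have [r1 sx] := supp_exists x; have [r2 sy] := supp_exists y; pose r := maxn r1 r2.
    have sxr : supp x r by apply: suppS sx; exact: leq_maxl.
    have syr : supp y r by apply: suppS sy; exact: leq_maxr.
    exists (pickle (existT _ r (restr r x, restr r y) : code)) => //.
    by rewrite /G pickleK /= !restrK.
  move=> [n _]; rewrite /G; case: unpickle => // -[K [u v]] /= [h1 h2 h3].
  by exists (emb u), (emb v).
rewrite UG; apply/negligibleP.
  by apply: bigcupT_measurable => n; rewrite /G; case: unpickle => // p; exact: mD.
apply: negligible_bigcup => n; rewrite /G; case: unpickle => [p|]; last exact: negligible_set0.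
by apply/negligibleP; [exact: mD | exact: D0].
Qed.

End Transfer.

Theorem theorem3p3 (R : realType) (N : nat) (hN : (1 < N)%N) :
  (* (a) *)
  (forall alpha C1 : R, 2 < alpha -> 0 <= C1 ->
     exists C0s C2s : R, [/\ 0 < C0s, 0 < C2s &
       forall C0 C2 : R, C0s < C0 -> C2s < C2 ->
       forall (d : measure_display) (T : measurableType d)
              (P : probability T R) (edge : Omega N -> Omega N -> set T),
         hier_model (ck C0 C1 C2 alpha) P edge ->
         percolates hN P edge /\ unique_infinite_cluster P edge]) /\
  (* (b) *)
  (forall alpha C0 C1 : R, 0 <= alpha -> 0 <= C0 -> 0 <= C1 -> C1 < N%:R ->
     forall (d : measure_display) (T : measurableType d)
            (P : probability T R) (edge : Omega N -> Omega N -> set T),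
       hier_model (ck C0 C1 0 alpha) P edge ->
       ~ percolates hN P edge) /\
  (* (c) *)
  (forall alpha : R, 2 < alpha ->
     exists Cs : R, 0 < Cs /\
       forall C0 C1 C2 : R, 0 <= C0 -> 0 <= C1 -> 0 <= C2 ->
         Num.max C0 (Num.max C1 C2) < Cs ->
       forall (d : measure_display) (T : measurableType d)
              (P : probability T R) (edge : Omega N -> Omega N -> set T),
         hier_model (ck C0 C1 C2 alpha) P edge ->
         ~ percolates hN P edge).
Proof.
split; last split.
- move=> alpha C1 a2 C10; have [C2s C2s0 sup] := supercritical hN a2.
  (* [C2s] comes from the construction of the scales; the witness 1 for the first threshold supplies
     [0 <= C0]. *)
  exists 1, C2s; split=> // C0 C2 C0s hC2 d T P edge model.
  have C00 : 0 <= C0 by apply: ltW; apply: lt_trans C0s.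
  have [perc uniq] := sup C0 C1 C2 C00 C10 hC2; split.
    apply: (percolates_of_escapes model) => k; have [K0 h] := perc k.
    exists K0 => K hK; apply: (h K) => //.
    + exact: ultra_words.
    + exact: (edge_pr01 hN model).
    + exact: (edge_pr2 hN model).
  apply: (unique_of_escapes (N1 := hN) model) => delta r d0; have [k h] := uniq delta r d0.
  exists k => K u v kK ur vr; apply: (h K) => //.
  + exact: ultra_words.
  + exact: (edge_pr01 hN model).
  + exact: (edge_pr2 hN model).
- move=> alpha C0 C1 a0 C00 C10 C1N d T P edge model.
  apply: (not_percolates model) => delta d0.
  have [j|k h] := @escape_log R N hN C0 C1 (ck C0 C1 0 alpha) delta C00 C10 C1N _ d0.
    by rewrite /ck mul0r addr0.
  exists k => K kK; apply: (h K) => //.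
  + exact: ultra_words.
  + exact: (edge_pr01 hN model).
  + exact: (edge_pr2 hN model).
- move=> alpha a2; have [|Cs Cs0 small] := @escape_small R N alpha hN.
    by apply: ltW; apply: lt_trans a2; rewrite ltr1n.
  exists Cs; split=> // C0 C1 C2 C00 C10 C20; rewrite !gt_max => /and3P[h0 h1 h2].
  move=> d T P edge model; apply: (not_percolates model) => delta d0.
  have [k h] := small C0 C1 C2 C00 C10 C20 h0 h1 h2 delta d0.
  exists k => K kK; apply: (h K).
  + exact: ultra_words.
  + exact: (edge_pr01 hN model).
  + exact: (edge_pr2 hN model).
Qed.
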